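(* A compactum $K\subset\mathbb{C}$ satisfies the Schönflies condition if and only if it has the following two properties: (1) every component of $K$ is a Peano continuum; (2) for every $C>0$, all but finitely many components of $K$ are of diameter less than $C$.
   Context: A compactum is a compact metric space; a continuum is a connected compactum; a Peano continuum is a locally connected continuum. For two parallel lines $L_1,L_2$ in the plane, $U(L_1,L_2)$ denotes the unbounded open strip bounded by them, i.e. the component of $\mathbb{C}\setminus(L_1\cup L_2)$ with boundary $L_1\cup L_2$. A compactum $K\subset\mathbb{C}$ satisfies the Schönflies condition if for any two (distinct) parallel lines $L_1,L_2$, with $U=U(L_1,L_2)$, the difference $\overline{U}\setminus K$ has at most finitely many components intersecting both $L_1$ and $L_2$. *)

(* Defs.v *)
From mathcomp Require Import all_boot all_order all_algebra.
From mathcomp Require Import all_classical all_reals.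
From mathcomp Require Import ereal topology normedtype.
From mathcomp Require Import complex.

Set Implicit Arguments.
Unset Strict Implicit.
Unset Printing Implicit Defensive.

Import Order.TTheory GRing.Theory Num.Theory.
Import numFieldNormedType.Exports.

Local Open Scope classical_set_scope.
Local Open Scope ring_scope.
Local Open Scope complex_scope.

(* The complex plane. The topology of a numFieldType is not inferred on R[i]
   itself but on its regular algebra R[i]^o; it is the topology of the modulus. *)
Notation plane R := (R[i]^o) (only parsing).

Section Topology.
Context {T : topologicalType}.
Implicit Types A B : set T.

Definition is_component A B : Prop :=
  exists2 x, A x & B = connected_component A x.

Definition boundary A : set T := closure A `\` interior A.

(* Local connectedness of A as a subspace of T: each point has a neighbourhood
   basis, in A, of connected sets that are open in A. *)
Definition locally_connected A : Prop :=
  forall (x : T) (O : set T), A x -> open O -> O x ->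
    exists W : set T,
      [/\ open W, W x, connected (A `&` W) & A `&` W `<=` O].

Definition peano_continuum A : Prop :=
  [/\ compact A, connected A & locally_connected A].

End Topology.

Section Plane.
Context {R : realType}.
Implicit Types (K L U : set (plane R)).

(* Normc.normc is the R-valued modulus; the supremum is taken in \bar R. *)
Definition diameter K : \bar R :=
  ereal_sup [set (Normc.normc (z.1 - z.2))%:E | z in K `*` K].

Definition line (p v : plane R) : set (plane R) :=
  [set p + t%:C *: v | t in [set: R]].

Definition parallel_lines L1 L2 : Prop :=
  exists p1 p2 v : plane R,
    [/\ v != 0, L1 = line p1 v & L2 = line p2 v].

(* For distinct parallel lines L1, L2 there is exactly one such U: the other two
   components of the complement have a single line as boundary. *)
Definition is_strip L1 L2 U : Prop :=
  is_component (~` (L1 `|` L2)) U /\ boundary U = L1 `|` L2.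

Definition schonflies K : Prop :=
  forall L1 L2 U, parallel_lines L1 L2 -> L1 <> L2 -> is_strip L1 L2 U ->
    finite_set [set A | [/\ is_component (closure U `\` K) A,
                            A `&` L1 !=set0 & A `&` L2 !=set0]].

End Plane.

(* Main.v *)
Require Import Defs.
From mathcomp Require Import all_boot all_order all_algebra.
From mathcomp Require Import all_classical all_reals.
From mathcomp Require Import ereal topology normedtype.
From mathcomp Require Import complex.
From mathcomp Require Import ring lra.

(** Call a subset of a closed strip S crossing when it meets both boundary
    lines.  The two sides of the equivalence are compared with a third
    condition, finitely_crossed: in every strip S, only finitely many components
    of K `&` S are crossing.

    The Schoenflies condition and finitely_crossed agree strip by strip
    (crossing_duality).  Put F = K `&` S.  Two points in different components of
    S `\` F are already separated in S by a single component of F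
    (separation_component), and two points in different components of F are
    separated in S by a single component of S `\` F (separation_gap).  If the
    two separated components cross, then so does the separating one: were it to
    miss a boundary line, this line would join them.  On the other hand a
    connected set E leaves at most two crossing components in S `\` E: of three,
    the middle one starts on the first line between two points of E and ends on
    the second line, so it would have to cut E (linking).  Hence a crossing
    component of one kind is determined by the side on which it lies of each
    crossing component of the other kind, and if the latter are finitely many,
    so are the former (crossing_transfer).

    Two facts of plane topology carry this.  The separation results come from
    the vanishing of the first Cech cohomology, with coefficients in Z/2, of a
    closed convex set.  It is used in the following explicit form
    (twistable_convex): given two colourings chi and V such that near every
    point one of them is constant, there is a colouring h that changes exactly
    where chi does so inside V.  Taking for V one piece of the separating set at
    a time cuts a colouring chi that distinguishes two points into
    contributions, one of which must still distinguish them.  The linking lemma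
    comes from a winding number: for E and V disjoint, x - y does not vanish on
    E * V, and replacing both sets by finite chains with small steps turns the
    count of its crossings of a half-axis along the boundary of the parameter
    rectangle into a finite sum modulo 2, which is both 0 and 1.

    It remains to compare finitely_crossed with the two properties of the
    components of K.  If both properties hold, the components of K that cross a
    given strip have diameter bounded below, so they are finitely many; and each
    of them is locally connected, so the compact set of its points on the middle
    line is covered by finitely many open sets, each meeting it inside a single
    component of K `&` S (peano_crossed).  Conversely, a component of large diameter
    crosses one of finitely many strips of a grid, which gives the second
    property (crossed_null).  For the first one, let A be a component of K and y
    a point of A.  Each component of the part of A in a square around y that
    comes near y reaches the boundary of the square, because A is connected
    (boundary_bumping), and so it crosses one of four rectangles cut off by
    horizontal or vertical strips.  A component that crosses such a rectangle
    without touching its two other sides is a component of K in the whole strip,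
    and two that touch the same side must meet, by the linking lemma.  So
    finitely many components of the part of A in the square come near y
    (finite_rect_crossing), and the one through y contains all points of A near
    y. *)

Set Implicit Arguments.
Unset Strict Implicit.
Unset Printing Implicit Defensive.
Import Order.TTheory GRing.Theory Num.Theory.
Import numFieldNormedType.Exports.
Local Open Scope classical_set_scope.
Local Open Scope ring_scope.
Local Open Scope complex_scope.

(** * Local-to-global principles for connected and compact sets *)

Definition loc_const (T : topologicalType) (U : Type) (g : T -> U) (A : set T) :=
  forall p, A p -> \forall x \near p, A x -> g x = g p.

Lemma loc_const_connected (T : topologicalType) (U : Type) (g : T -> U)
    (A : set T) :
  connected A -> loc_const g A -> forall x y, A x -> A y -> g x = g y.
Proof.
move=> cA lA x y Ax Ay.
suff /seteqP[_ /(_ y Ay)[_ <-//]] : A `&` [set z | g x = g z] = A.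
apply: cA; first by exists x.
- exists [set z | A z -> g x = g z]°; first exact: open_interior.
  apply/seteqP; split => z [Az].
    by move=> /= ->; split=> //; near=> t => At; apply/esym; move: At; near: t; exact: lA.
  by move=> /interior_subset/(_ Az).
- exists (~` [set z | A z -> g x <> g z]°).
    by apply: open_closedC; exact: open_interior.
  apply/seteqP; split => z [Az].
    by move=> gxz; split=> // /interior_subset/(_ Az).
  move=> nz; split=> //=; apply: contrapT => gxz; apply: nz.
  near=> t => At; have -> : g t = g z by move: At; near: t; exact: lA.
  exact: gxz.
Unshelve. all: by end_near. Qed.

(** This replaces finite chains of small steps: what passes between nearby points
    of A, in both directions, passes between any two. *)
Lemma connected_ind (T : topologicalType) (A : set T) (Pr : T -> Prop) :
  connected A -> (forall p, A p -> \forall x \near p, A x -> (Pr x <-> Pr p)) ->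
  forall x y, A x -> A y -> Pr x -> Pr y.
Proof.
move=> cA lA x y Ax Ay; rewrite (@loc_const_connected _ _ Pr A cA _ x y)//.
by move=> p /lA; apply: filterS => z h Az; apply/propext; exact: h.
Qed.

(** Near-covering, applied to the filter of the families that contain all large
    enough sets with the property, gives one such set that contains K. *)
Lemma compact_ind (T : topologicalType) (Pr : set T -> Prop) (K : set T) :
  compact K -> Pr set0 -> (forall A B, A `<=` B -> Pr B -> Pr A) ->
  (forall A B, Pr A -> Pr B -> Pr (A `|` B)) ->
  (forall x, K x -> exists2 W, nbhs x W & Pr (K `&` W)) -> Pr K.
Proof.
move=> /compact_near_coveringP cK P0 Ps PU loc.
pose F : set_system (set T) :=
  [set S | exists2 A, Pr A & forall B, Pr B -> A `<=` B -> S B].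
have FF : Filter F.
  split.
  - by exists set0.
  - move=> P Q [A PA hA] [B PB hB]; exists (A `|` B); first exact: PU.
    move=> C PC ABC; split; [apply: hA|apply: hB] => // x Ax; apply: ABC.
      by left.
    by right.
  - by move=> P Q PQ [A PA hA]; exists A => // B PB AB; apply: PQ; exact: hA.
have [A PA hA] : \near F, K `<=` (fun B x => K x -> B x) F.
  apply: cK => x Kx; have [W xW PW] := loc x Kx.
  exists (W, [set B | K `&` W `<=` B]); last by move=> [y B] /= [Wy KB] Ky; exact: KB.
  split=> //=; by exists (K `&` W).
have KA := hA _ PA (@subset_refl _ _).
by apply: Ps PA => x Kx; exact: (KA x Kx Kx).
Qed.

(** * Linear coordinates on the plane *)

Section Coordinates.
Context {R : realType}.
Implicit Types (x y z n : plane R).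

(** The Euclidean inner product of R^2.  Every strip is a slab of dot n for a
    vector n orthogonal to its boundary lines, and dot (n * 'i) is then the
    coordinate along the lines. *)
Definition dot n z : R := complex.Re n * complex.Re z + complex.Im n * complex.Im z.

Lemma dotB n x y : dot n (x - y) = dot n x - dot n y.
Proof. by case: n x y => a b [c d] [e f]; rewrite /dot /=; ring. Qed.

(** Additive coordinates that define the topology.  The sign and the order of the
    two coordinates do not matter, which makes it possible to treat the four
    sides of a rectangle by one argument. *)
Definition coords (a b : plane R -> R) :=
  [/\ forall x y, a (x - y) = a x - a y, forall x y, b (x - y) = b x - b y &
   forall x U, nbhs x U <-> exists2 e, 0 < e &
     forall y, `|a y - a x| < e -> `|b y - b x| < e -> U y].

Lemma coords_sym a b : coords a b -> coords b a.
Proof.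
case=> ha hb h; split=> // x U; split.
  by move=> /h[e e0 he]; exists e => // y *; exact: he.
by move=> [e e0 he]; apply/h; exists e => // y *; exact: he.
Qed.

Lemma coordsN a b : coords a b -> coords (fun z => - a z) b.
Proof.
have E x y : `|- a x - - a y| = `|a x - a y| by rewrite -opprD normrN.
case=> ha hb h; split=> //; first by move=> x y; rewrite ha opprB opprK addrC.
move=> x U; split.
  by move=> /h[e e0 he]; exists e => // y; rewrite E; exact: he.
by move=> [e e0 he]; apply/h; exists e => // y; rewrite -E; exact: he.
Qed.

Lemma dot_sqr n z :
  dot n z ^+ 2 + dot (n * 'i) z ^+ 2 =
  (complex.Re n ^+ 2 + complex.Im n ^+ 2) * (complex.Re z ^+ 2 + complex.Im z ^+ 2).
Proof. by case: n z => a b [c d]; rewrite /dot /=; ring. Qed.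

Lemma sqrtC_lt (a : R) (e : R) : 0 < e -> 0 <= a ->
  (((Num.sqrt a)%:C : plane R) < e%:C) = (a < e ^+ 2).
Proof.
move=> e0 a0; rewrite ltcR -{1}(gtr0_norm e0) -sqrtr_sqr ltr_sqrt //.
by rewrite exprn_gt0.
Qed.

Lemma dot_self_gt0 n : n != 0 -> 0 < dot n n.
Proof.
move=> n0; rewrite lt_neqAle addr_ge0 -?expr2 ?sqr_ge0// andbT eq_sym.
apply: contra n0; rewrite paddr_eq0 ?sqr_ge0// !sqrf_eq0.
by case: n => a b /= /andP[/eqP -> /eqP ->].
Qed.

(** By Lagrange's identity dot_sqr, the two coordinates together are |n| times an
    isometry. *)
Lemma coords_dot n : n != 0 -> coords (dot n) (dot (n * 'i)).
Proof.
move=> n0; split; [exact: dotB|exact: dotB|].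
pose m := complex.Re n ^+ 2 + complex.Im n ^+ 2.
have m0 : 0 < m by have := dot_self_gt0 n0; rewrite /dot -!expr2.
have E e x y : 0 < e -> (ball x e%:C y) = (dot n (y - x) ^+ 2 + dot (n * 'i) (y - x) ^+ 2 <
  m * e ^+ 2) :> Prop.
  move=> e0; rewrite dot_sqr -/m ltr_pM2l// -ball_normE /ball_ /= distrC normc_def.
  by rewrite sqrtC_lt// addr_ge0// sqr_ge0.
move=> x U; split.
  move=> /nbhs_ballP[[d d'] /= d0 xeU].
  have dd : d' = 0 /\ 0 < d by move: d0; rewrite ltcE /= => /andP[/eqP-> ->].
  case: dd => d'0 dgt; subst d'.
  pose s := Num.sqrt (m / 2%:R); have s0 : 0 < s by rewrite sqrtr_gt0 divr_gt0.
  exists (s * d); first by rewrite mulr_gt0.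
  have s2 : (s * d) ^+ 2 = m / 2%:R * d ^+ 2 by rewrite exprMn sqr_sqrtr// ltW// divr_gt0.
  have sq (r t : R) : `|r| < t -> r ^+ 2 < t ^+ 2.
    by move=> rt; rewrite -real_normK ?num_real// ltr_pXn2r// ?nnegrE// (le_trans _ (ltW rt)).
  move=> y; rewrite -!dotB => /sq h1 /sq h2; apply: xeU.
  have := E d x y dgt; rewrite /= => ->; move: h1 h2; rewrite s2; lra.
move=> [e e0 eU]; apply/nbhs_ballP.
pose s := Num.sqrt (e ^+ 2 / m); have s0 : 0 < s by rewrite sqrtr_gt0 divr_gt0// exprn_gt0.
have s2 : m * s ^+ 2 = e ^+ 2.
  by rewrite sqr_sqrtr ?ltW// ?divr_gt0 ?exprn_gt0// mulrCA divff ?gt_eqF// mulr1.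
exists s%:C; first by rewrite /= ltcR.
move=> y; rewrite E// s2 => h.
have sq (r : R) : r ^+ 2 < e ^+ 2 -> `|r| < e.
  by rewrite -(real_normK (num_real r)) ltr_pXn2r// nnegrE// ltW.
apply: eU; rewrite -!dotB; apply: sq; apply: le_lt_trans h.
  by rewrite lerDl sqr_ge0.
by rewrite lerDr sqr_ge0.
Qed.

End Coordinates.

(** * Separation and components in the plane *)

Section PlaneTopology.
Context {R : realType}.
Implicit Types (x y z n p : plane R) (A B F M O : set (plane R)).

Lemma plane_hausdorff : hausdorff_space (plane R).
Proof. exact: norm_hausdorff. Qed.

Lemma plane_compact_closed A : compact A -> closed A.
Proof. by apply: compact_closed; exact: plane_hausdorff. Qed.

Lemma coords_inj (a b : plane R -> R) x y : coords a b -> a x = a y -> b x = b y -> x = y.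
Proof.
move=> [_ _ h] h1 h2; apply: plane_hausdorff => A B xA yB; exists x.
split; first exact: nbhs_singleton.
by have /h[e e0 hB] := yB; apply: hB; rewrite ?h1 ?h2 subrr normr0.
Qed.

Lemma coords_continuous (a b : plane R -> R) : coords a b -> continuous a.
Proof.
case => _ _ h x U /nbhs_ballP[e e0 eU].
by apply/h; exists e => // y ay _; apply: eU; rewrite /ball /= distrC.
Qed.

Definition sq x (e : R) : set (plane R) :=
  [set y | `|complex.Re y - complex.Re x| < e /\ `|complex.Im y - complex.Im x| < e].

Lemma coords_ReIm : coords (@complex.Re R) (@complex.Im R).
Proof.
have -> : @complex.Re R = dot 1.
  by apply/funext => -[a b]; rewrite /dot /= mul1r mul0r addr0.
have -> : @complex.Im R = dot (1 * 'i).
  by apply/funext => -[a b]; rewrite /dot /=; ring.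
by apply: coords_dot; exact: oner_neq0.
Qed.

Lemma near_notin A x : closed A -> ~ A x -> \forall z \near x, ~ A z.
Proof.
by move=> cA nA; apply: open_nbhs_nbhs; split=> //; exact: closed_openC.
Qed.

Lemma near_in A x : open A -> A x -> \forall z \near x, A z.
Proof. by move=> oA Ax; exact: open_nbhs_nbhs. Qed.

Lemma near_all (P : plane R -> Prop) p : (forall z, P z) -> \forall z \near p, P z.
Proof. by move=> PT; apply: filterS (near_in openT (I : setT p)) => z _. Qed.

Lemma nbhs_sq x A : nbhs x A <-> exists2 e, 0 < e & sq x e `<=` A.
Proof.
case: coords_ReIm => _ _ ->; split=> -[e e0 h]; exists e => //.
  by move=> y []; exact: h.
by move=> y *; apply: h.
Qed.

Lemma open_sq x e : open (sq x e).
Proof.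
rewrite openE => y [h1 h2]; apply/nbhs_sq.
pose d := Num.min (e - `|complex.Re y - complex.Re x|) (e - `|complex.Im y - complex.Im x|).
exists d; first by rewrite lt_min !subr_gt0 h1.
move=> z; rewrite /sq /= !lt_min => -[/andP[z1 z2] /andP[z3 z4]].
split.
  rewrite -(subrKA (complex.Re y)); apply: le_lt_trans (ler_normD _ _) _; lra.
rewrite -(subrKA (complex.Im y)); apply: le_lt_trans (ler_normD _ _) _; lra.
Qed.

Lemma sq_center x e : 0 < e -> sq x e x.
Proof. by move=> e0; rewrite /sq /= !subrr normr0. Qed.

(** Each set is thickened around each of its points by half of a distance at
    which the other set is not yet met. *)
Lemma plane_normal A B : closed A -> closed B -> A `&` B = set0 ->
  exists O1 O2, [/\ open O1, open O2, A `<=` O1, B `<=` O2 & O1 `&` O2 = set0].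
Proof.
pose N A B := \bigcup_(xe in [set xe : plane R * R |
  [/\ A xe.1, 0 < xe.2 & sq xe.1 (2 * xe.2) `&` B = set0]]) sq xe.1 xe.2.
have Nopen X Y : open (N X Y) by apply: bigcup_open => xe _; exact: open_sq.
have Nsub X Y : closed Y -> X `&` Y = set0 -> X `<=` N X Y.
  move=> cY XY x Xx; have : nbhs x (~` Y).
    apply: open_nbhs_nbhs; split; first exact: closed_openC.
    by move=> Yx; have : (X `&` Y) x by []; rewrite XY.
  move=> /nbhs_sq[e e0 sY]; exists (x, e / 2); last by apply: sq_center; rewrite divr_gt0.
  split=> //=; first by rewrite divr_gt0.
  rewrite mulrC divfK//; by apply/disjoints_subset.
move=> cA cB AB; exists (N A B), (N B A); split=> //; [exact: Nsub| |].
  by apply: Nsub => //; rewrite setIC.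
apply/seteqP; split=> // z [[[x e] /= [Ax e0 xB] [z1 z2]] [[y d] /= [By d0 yA] [z3 z4]]].
have yx : sq x (2 * e) y \/ sq y (2 * d) x.
  rewrite /sq /=; case: (leP d e) => ed; [left|right].
    rewrite -(subrKA (complex.Re z)) -(subrKA (complex.Im z) (complex.Im y)).
    rewrite distrC in z3; rewrite distrC in z4.
    split; apply: le_lt_trans (ler_normD _ _) _; lra.
  rewrite -(subrKA (complex.Re z)) -(subrKA (complex.Im z) (complex.Im x)).
  rewrite distrC in z1; rewrite distrC in z2.
  split; apply: le_lt_trans (ler_normD _ _) _; lra.
case: yx => h.
  by have : (sq x (2 * e) `&` B) y by []; rewrite xB.
by have : (sq y (2 * d) `&` A) x by []; rewrite yA.
Qed.

Definition clopen_in F A := [/\ closed A, closed (F `\` A) & A `<=` F].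

Lemma clopen_inI F A B : clopen_in F A -> clopen_in F B -> clopen_in F (A `&` B).
Proof.
move=> [cA cA' AF] [cB cB' BF]; split; first exact: closedI.
  by rewrite setDIr; exact: closedU.
by move=> x [/AF].
Qed.

Lemma clopen_inC F A : clopen_in F A -> clopen_in F (F `\` A).
Proof.
by move=> [cA cA' AF]; split=> //; rewrite setDD setIidr.
Qed.

Definition quasi_component F x : set (plane R) :=
  [set y | forall A, clopen_in F A -> A x -> A y].

(** A compact M avoiding the quasi-component is covered by the complements of
    the clopen sets through x, hence by the complement of one of them, because
    these are stable under finite intersections. *)
Lemma quasi_component_split F x M : compact F -> F x -> closed M ->
  M `&` quasi_component F x = set0 ->
  exists A, [/\ clopen_in F A, A x & A `&` M = set0].
Proof.
move=> cF Fx cM MQ.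
have clF := plane_compact_closed cF.
pose Pr Z := exists A, [/\ clopen_in F A, A x & A `&` Z = set0].
suff [A [hA Ax AM]] : Pr (F `&` M).
  exists A; split=> //; apply/seteqP; split=> // y [Ay My].
  by rewrite -AM; split=> //; split=> //; case: hA => _ _; exact.
apply: (compact_ind (Pr := Pr)).
- by apply: compact_closedI => //.
- exists F; split=> //; last by rewrite setI0.
  by split=> //; rewrite setDv; exact: closed0.
- move=> X Y XY [A [hA Ax AY]]; exists A; split=> //.
  by apply/seteqP; split=> // y [Ay /XY Yy]; rewrite -AY.
- move=> X Y [A [hA Ax AX]] [B [hB Bx BY]]; exists (A `&` B); split=> //.
    exact: clopen_inI.
  apply/seteqP; split=> // y [[Ay By] [Xy|Yy]]; [by rewrite -AX|by rewrite -BY].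
move=> y [Fy My].
have : ~ quasi_component F x y by move=> Qy; rewrite -[False]/(set0 y) -MQ.
move=> /existsNP[A /not_implyP[hA /not_implyP[Ax nAy]]].
exists (~` A).
  apply: open_nbhs_nbhs; split=> //; apply: closed_openC; by case: hA.
exists A; split=> //; apply/seteqP; by split=> // z [Az [_ nAz]].
Qed.

(** If the quasi-component falls into two disjoint closed pieces, disjoint open
    sets around them cut a small clopen neighbourhood of the quasi-component into
    two clopen parts; the part containing x misses one of the pieces. *)
Lemma quasi_component_connected F x : compact F -> F x ->
  connected (quasi_component F x).
Proof.
move=> cF Fx; set Q := quasi_component F x.
have clF := plane_compact_closed cF.
have Qx : Q x by move=> A.
have clQ : closed Q.
  rewrite (_ : Q = \bigcap_(A in [set A | clopen_in F A /\ A x]) A).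
    by apply: closed_bigI => A [[]].
  apply/seteqP; split=> y Qy A; first by move=> [hA Ax]; exact: Qy.
  by move=> hA Ax; exact: Qy.
have FF : clopen_in F F by split=> //; rewrite setDv; exact: closed0.
have QF : Q `<=` F by move=> y; exact.
apply/connectedP => E [E0 QE [s1 s2]].
have cE : forall c, closed (E c).
  move=> c; rewrite closure_id; apply/seteqP; split; first exact: subset_closure.
  move=> y cy; have : Q y.
    rewrite closure_id in clQ; rewrite clQ.
    by apply: closure_subset cy; rewrite QE; case: (c); [exact: subsetUr|exact: subsetUl].
  rewrite QE; case: c cy => cy [] // Ey.
    by exfalso; rewrite -[False]/(set0 y) -s2.
  by exfalso; rewrite -[False]/(set0 y) -s1.
have E01 : E false `&` E true = set0.
  by apply/seteqP; split=> // y [y0 y1]; rewrite -s1; split=> //; exact: subset_closure.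
have [O1 [O2 [oO1 oO2 EO1 EO2 O12]]] := plane_normal (cE _) (cE _) E01.
pose O c := if c then O2 else O1.
have oO c : open (O c) by case: c.
have EO c : E c `<=` O c by case: c.
have [||A [hA Ax AM]] := @quasi_component_split F x (~` (O1 `|` O2)) cF Fx.
- by apply: open_closedC; exact: openU.
- apply/seteqP; split=> // y [nO]; rewrite -/Q QE => -[/EO1|/EO2] h; apply: nO; [by left|by
  right].
have AO y : A y -> O1 y \/ O2 y.
  move=> Ay; apply: contrapT => nO; rewrite -[False]/(set0 y) -AM; split=> //.
have [c Ec] : exists c, E c x.
  by move: Qx; rewrite QE => -[]; [exists false|exists true].
have hA' : clopen_in F (A `&` O c).
  have [cA cA' AF] := hA; split; last by move=> y [/AF].
    rewrite (_ : A `&` O c = A `&` ~` O (~~ c)).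
      by apply: closedI => //; exact: open_closedC.
    apply/seteqP; split=> y [Ay]; rewrite /O.
      by case: c {Ec} => /= Oy; split=> // Oy'; rewrite -[False]/(set0 y) -O12.
    by case: c {Ec} => /= nO; split=> //; case: (AO _ Ay).
  rewrite setDIr; apply: closedU => //; apply: closedI => //; exact: open_closedC.
have [y Ey] := E0 (~~ c).
have Qy : Q y by rewrite QE; case: c {Ec hA'} Ey; [left|right].
have [_ Ocy] : (A `&` O c) y by apply: Qy => //; split=> //; exact: EO.
have := EO _ _ Ey; rewrite -[False]/(set0 y) -O12.
by move: Ocy; rewrite /O; case: (c).
Qed.

Lemma component_split F x M : compact F -> F x -> closed M ->
  M `&` connected_component F x = set0 ->
  exists A, [/\ clopen_in F A, A x & A `&` M = set0].
Proof.
move=> cF Fx cM MC; apply: quasi_component_split => //.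
apply/seteqP; split=> // y [My Qy]; rewrite -MC; split=> //.
have FF : clopen_in F F.
  by split=> //; [exact: plane_compact_closed|rewrite setDv; exact: closed0].
apply: (@connected_component_max _ F (quasi_component F x)) => //.
  by move=> z; exact.
exact: quasi_component_connected.
Qed.

(** Otherwise a clopen subset of P `&` M around the component stays in O; it is
    then also clopen in P, hence all of P. *)
Lemma boundary_bumping P M O z : compact P -> connected P -> P z -> closed M ->
  open O -> O `<=` M -> connected_component (P `&` M) z `<=` O -> M z -> P `<=` M.
Proof.
move=> cP coP Pz cM oO OM CO Mz.
have cF : compact (P `&` M) by apply: compact_closedI.
have [||A [[cA cA' AF] Az AO]] := @component_split (P `&` M) z (~` O) cF (conj Pz Mz).
- exact: open_closedC.
- by apply/seteqP; split=> // y [nOy /CO].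
have AO' : A `<=` O by move=> y Ay; apply: contrapT => nO; rewrite -[False]/(set0 y) -AO.
suff <- : A = P by move=> y /AF[].
apply: coP; first by exists z.
  exists (O `&` ~` ((P `&` M) `\` A)); first by apply: openI => //; exact: closed_openC.
  apply/seteqP; split=> y.
    by move=> Ay; have [Py My] := AF _ Ay; split=> //; split; [exact: AO'|move=> []].
  by move=> [Py [Oy nA]]; apply: contrapT => nAy; apply: nA; split=> //; split=> //; exact: OM.
by exists A => //; apply/esym/setIidr => y /AF[].
Qed.

Lemma component_compact F z : compact F -> compact (connected_component F z).
Proof.
move=> cF; apply: (@subclosed_compact _ _ F) => //.
  by apply: component_closed; exact: plane_compact_closed.
exact: connected_component_sub.
Qed.

Lemma closed_sublevel (f : plane R -> R) c : continuous f -> closed [set z | f z <= c].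
Proof.
move=> cf; rewrite (_ : [set _ | _] = f @^-1` [set x | x <= c])//.
by apply: closed_comp => [z _|]; [exact: cf|exact: closed_le].
Qed.

Lemma closed_superlevel (f : plane R -> R) c : continuous f -> closed [set z | c <= f z].
Proof.
move=> cf; rewrite (_ : [set _ | _] = f @^-1` [set x | c <= x])//.
by apply: closed_comp => [z _|]; [exact: cf|exact: closed_ge].
Qed.

Lemma open_superlevel (f : plane R -> R) c : continuous f -> open [set z | c < f z].
Proof.
move=> cf; rewrite (_ : [set _ | _] = ~` [set x | f x <= c]).
  by apply: closed_openC; exact: closed_sublevel.
by apply/seteqP; split=> z /=; rewrite ltNge => /negP.
Qed.

Lemma open_sublevel (f : plane R -> R) c : continuous f -> open [set z | f z < c].
Proof.
move=> cf; rewrite (_ : [set _ | _] = ~` [set x | c <= f x]).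
  by apply: closed_openC; exact: closed_superlevel.
by apply/seteqP; split=> z /=; rewrite ltNge => /negP.
Qed.

(** Boundary bumping twice: once to descend from y to the level s inside
    {f >= s}, then to climb from there to the level t inside {f <= t}. *)
Lemma crossing (f : plane R -> R) P (s t : R) x y : continuous f ->
  compact P -> connected P -> s < t -> P x -> f x <= s -> P y -> t <= f y ->
  exists z, [/\ P z, f z = s & exists2 w,
    connected_component (P `&` [set z | s <= f z <= t]) z w & f w = t].
Proof.
move=> cf cP coP st Px xs Py ty.
pose C1 := connected_component (P `&` [set z | s <= f z]) y.
have cS : compact (P `&` [set z | s <= f z]).
  by apply: compact_closedI => //; exact: closed_superlevel.
have cC1 : compact C1 by exact: component_compact.
have C1P : C1 `<=` P `&` [set z | s <= f z] by exact: connected_component_sub.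
have C1y : C1 y.
  by apply: connected_component_refl; split=> //=; rewrite (le_trans _ ty)// ltW.
have [w C1w ws] : exists2 w, C1 w & f w = s.
  suff [w C1w ws] : exists2 w, C1 w & f w <= s.
    by exists w => //; apply/eqP; rewrite eq_le ws; have [_ ->] := C1P _ C1w.
  apply: contrapT => nw.
  have PM : P `<=` [set z | s <= f z].
    apply: (@boundary_bumping P _ [set z | s < f z] y) => //.
    - exact: closed_superlevel.
    - exact: open_superlevel.
    - by move=> z /ltW.
    - by move=> z C1z /=; rewrite ltNge; apply/negP => zs; apply: nw; exists z.
    - by case: (C1P _ C1y).
  apply: nw; exists x => //; apply: (connected_component_max (B := P)) => //.
  by move=> z Pz; split=> //; exact: PM.
pose C2 := connected_component (C1 `&` [set z | f z <= t]) w.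
have C2w : C2 w by apply: connected_component_refl; split=> //=; rewrite ws ltW.
have C2C : C2 `<=` C1 `&` [set z | f z <= t] by exact: connected_component_sub.
have [v C2v vt] : exists2 v, C2 v & f v = t.
  suff [v C2v vt] : exists2 v, C2 v & t <= f v.
    by exists v => //; apply/eqP; rewrite eq_le vt; have [_ ->] := C2C _ C2v.
  apply: contrapT => nw.
  have PM : C1 `<=` [set z | f z <= t].
    apply: (@boundary_bumping C1 _ [set z | f z < t] w) => //.
    - exact: component_connected.
    - exact: closed_sublevel.
    - exact: open_sublevel.
    - by move=> z /ltW.
    - by move=> z C2z /=; rewrite ltNge; apply/negP => zs; apply: nw; exists z.
    - by case: (C2C _ C2w).
  apply: nw; exists y => //; apply: (connected_component_max (B := C1)) => //.
    by move=> z Pz; split=> //; exact: PM.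
  exact: component_connected.
exists w; split=> //; first by case: (C1P _ C1w).
exists v => //; apply: (connected_component_max (B := C2)) => //; last exact:
  component_connected.
by move=> z /C2C[/C1P[Pz sz] zt]; split=> //=; rewrite sz.
Qed.

End PlaneTopology.

(** * Convex sets *)

Section Convex.
Context {R : realType}.
Implicit Types (x y z n : plane R) (A B F M O P S : set (plane R)).

Definition seg x y (t : R) : plane R :=
  (complex.Re x + t * (complex.Re y - complex.Re x)) +i*
  (complex.Im x + t * (complex.Im y - complex.Im x)).

Lemma dot_seg n x y t : dot n (seg x y t) = dot n x + t * (dot n y - dot n x).
Proof. by rewrite /dot /=; ring. Qed.

(** Convexity is stated with segments given in coordinates, since only their
    real and imaginary parts are ever computed. *)
Definition convex S := forall x y t, S x -> S y -> 0 <= t <= 1 -> S (seg x y t).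

Lemma seg0 x y : seg x y 0 = x.
Proof. by case: x => a b; rewrite /seg /= !mul0r !addr0. Qed.

Lemma seg1 x y : seg x y 1 = y.
Proof. by case: x y => a b [c d]; rewrite /seg /= !mul1r !subrKC. Qed.

Lemma pair_continuous : continuous (fun p : R * R => p.1 +i* p.2 : plane R).
Proof.
move=> [a b] U /nbhs_sq[e e0 eU]; exists (ball a e, ball b e).
  by split; exact: nbhsx_ballx.
by move=> [c d] [/= h1 h2]; apply: eU; rewrite /sq /= ![`|_ - a|]distrC ![`|_ - b|]distrC.
Qed.

Lemma seg_continuous x y : continuous (seg x y).
Proof.
move=> t.
pose f (a b : R) (t : R) : R := a + t * (b - a).
have cf a b : continuous (f a b).
  by move=> u; apply: cvgD; [exact: cvg_cst|apply: cvgM; [exact: cvg_id|exact: cvg_cst]].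
have h : {for t, continuous (fun t : R => (f (complex.Re x) (complex.Re y) t, f (complex.Im
  x) (complex.Im y) t))}.
  exact: cvg_pair (cf _ _ t) (cf _ _ t).
exact: (continuous_comp h (@pair_continuous _)).
Qed.

Definition segment x y := [set seg x y t | t in `[0, 1]%classic].

Lemma segmentP S x y : convex S -> S x -> S y -> segment x y `<=` S.
Proof. by move=> cS Sx Sy z [t]; rewrite /= in_itv /= => ht <-; exact: cS. Qed.

Lemma segment_l x y : segment x y x.
Proof. by exists 0; rewrite ?seg0//= in_itv /= lexx ler01. Qed.

Lemma segment_r x y : segment x y y.
Proof. by exists 1; rewrite ?seg1//= in_itv /= lexx ler01. Qed.

Lemma connected_seg x y : connected (segment x y).
Proof.
apply: connected_continuous_connected; first exact: segment_connected.
apply: continuous_subspaceT; exact: seg_continuous.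
Qed.

Lemma compact_seg x y : compact (segment x y).
Proof.
apply: continuous_compact; last exact: segment_compact.
apply: continuous_subspaceT; exact: seg_continuous.
Qed.

Lemma convex_connected S : convex S -> connected S.
Proof.
move=> cS; have [->|/set0P[x Sx]] := eqVneq S set0; first exact: connected0.
have -> : S = \bigcup_(y in S) segment x y.
  apply/seteqP; split=> y; first by move=> Sy; exists y => //; exact: segment_r.
  by move=> [z Sz]; exact: segmentP.
apply: bigcup_connected => [|y _]; last exact: connected_seg.
by exists x => y _; exact: segment_l.
Qed.

Lemma conv_le (a b c t : R) : a <= c -> b <= c -> 0 <= t <= 1 -> a + t * (b - a) <= c.
Proof. by move=> ac bc /andP[t0 t1]; nra. Qed.

Lemma conv_ge (a b c t : R) : c <= a -> c <= b -> 0 <= t <= 1 -> c <= a + t * (b - a).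
Proof. by move=> ac bc /andP[t0 t1]; nra. Qed.

Lemma conv_lt (a b c t : R) : a < c -> b < c -> 0 <= t <= 1 -> a + t * (b - a) < c.
Proof.
move=> ac bc t01; apply: (@le_lt_trans _ _ (Num.max a b)); last by rewrite gt_max ac.
by apply: conv_le; rewrite ?le_max ?lexx ?orbT.
Qed.

Lemma conv_gt (a b c t : R) : c < a -> c < b -> 0 <= t <= 1 -> c < a + t * (b - a).
Proof.
move=> ac bc t01; apply: (@lt_le_trans _ _ (Num.min a b)); first by rewrite lt_min ac.
by apply: conv_ge; rewrite ?ge_min ?lexx ?orbT.
Qed.

Lemma convexI A B : convex A -> convex B -> convex (A `&` B).
Proof. by move=> cA cB x y t [Ax Bx] [Ay By] t01; split; [exact: cA|exact: cB]. Qed.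

Lemma convex_sq x e : convex (sq x e).
Proof.
have hc (a b c t : R) : `|a - c| < e -> `|b - c| < e -> 0 <= t <= 1 ->
    `|a + t * (b - a) - c| < e.
  rewrite !ltr_distl => /andP[? ?] /andP[? ?] ?.
  by apply/andP; split; [exact: conv_gt|exact: conv_lt].
by move=> y z t [y1 y2] [z1 z2] t01; split; exact: hc.
Qed.

Definition rect (a b c d : R) : set (plane R) :=
  [set z | [/\ a <= complex.Re z, complex.Re z <= b, c <= complex.Im z & complex.Im z <= d]].

Lemma convex_rect a b c d : convex (rect a b c d).
Proof. by move=> x y t [? ? ? ?] [? ? ? ?] t01; split; [exact: conv_ge|exact:
  conv_le|exact: conv_ge|exact: conv_le]. Qed.

Lemma Re_continuous : continuous (@complex.Re R : plane R -> R).
Proof. exact: (coords_continuous coords_ReIm). Qed.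

Lemma Im_continuous : continuous (@complex.Im R : plane R -> R).
Proof. exact: (coords_continuous (coords_sym coords_ReIm)). Qed.

Lemma closed_rect a b c d : closed (rect a b c d).
Proof.
rewrite (_ : rect a b c d =
  ([set z | a <= complex.Re z] `&` [set z | complex.Re z <= b]) `&`
  ([set z | c <= complex.Im z] `&` [set z | complex.Im z <= d])).
  by do 2 apply: closedI; (apply: closed_superlevel || apply: closed_sublevel);
    (exact: Re_continuous || exact: Im_continuous).
by apply/seteqP; split=> z; [case|case=> -[? ?] [? ?]].
Qed.

Lemma compact_rect a b c d : compact (rect a b c d).
Proof.
rewrite (_ : rect a b c d = (fun p : R * R => p.1 +i* p.2 : plane R) @` (`[a, b] `*` `[c, d])).
  apply: continuous_compact; last by apply: compact_setX; exact: segment_compact.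
  apply: continuous_subspaceT; exact: pair_continuous.
apply/seteqP; split=> z.
  case: z => u v [/= ? ? ? ?]; exists (u, v) => //.
  by split; rewrite /= in_itv /=; apply/andP.
by move=> [[u v] /= []]; rewrite /= !in_itv /= => /andP[? ?] /andP[? ?] <-.
Qed.

(** Convex sets are locally connected, so the components of a relatively open
    subset are relatively open. *)
Lemma component_near S F u p : convex S -> closed F -> (S `\` F) p ->
  \forall z \near p, S z ->
    (S `\` F) z /\ (connected_component (S `\` F) u z <-> connected_component (S `\` F) u p).
Proof.
move=> cS cF [Sp nFp].
have := near_notin cF nFp.
move=> /nbhs_sq[e e0 sF]; apply/nbhs_sq; exists e => // z zp Sz.
have pz : connected_component (S `\` F) p z.
  apply: (connected_component_max (B := S `&` sq p e)) => //.
  - by split=> //; exact: sq_center.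
  - by move=> y [Sy /sF].
  - by apply: convex_connected; apply: convexI => //; exact: convex_sq.
split; first exact: (connected_component_sub pz).
split=> h; apply: connected_component_trans h _ => //.
exact: connected_component_sym.
Qed.

Lemma component_compl_closed S F u : closed S -> convex S -> closed F ->
  closed (S `\` connected_component (S `\` F) u).
Proof.
move=> clS cS cF; rewrite -[X in closed X]setCK; apply: open_closedC.
rewrite openE => p np; rewrite /interior.
have [Sp|nSp] := pselect (S p); last first.
  by apply: filterS (near_notin clS nSp) => z nSz [].
have Up : connected_component (S `\` F) u p.
  by apply: contrapT => nU; apply: np.
have := component_near u cS cF (connected_component_sub Up).
by apply: filterS => z h [/h[_ [_ b]] nU]; apply: nU; exact: b.
Qed.

(** Only a compact connected set is needed below, so segments are glued without
    parametrizing a path. *)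
Lemma component_arc S F u v : convex S -> closed F -> (S `\` F) u ->
  connected_component (S `\` F) u v ->
  exists G, [/\ compact G, connected G, G `<=` S `\` F, G u & G v].
Proof.
move=> cS cF Su uv.
pose Pr v := exists G, [/\ compact G, connected G, G `<=` S `\` F, G u & G v].
have cC : connected (connected_component (S `\` F) u) by exact: component_connected.
suff : Pr v by [].
apply: (connected_ind (Pr := Pr) cC _ _ uv (x := u)); last first.
- by exists [set u]; split=> //; [exact: compact_set1|exact: connected1|move=> _ ->].
- exact: connected_component_refl.
move=> p up; have [Sp nFp] := connected_component_sub up.
have := near_notin cF nFp.
move=> /nbhs_sq[e e0 sF]; apply/nbhs_sq; exists e => // z zp uz.
have [Sz _] := connected_component_sub uz.
have SF x y : S x -> sq p e x -> S y -> sq p e y -> segment x y `<=` S `\` F.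
  move=> Sx px Sy py w xyw; split.
    by apply: (segmentP cS Sx Sy).
  by apply: sF; apply: (segmentP (@convex_sq p e) px py).
have ext x y : S x -> sq p e x -> S y -> sq p e y -> Pr x -> Pr y.
  move=> Sx px Sy py [G [cG coG GS Gu Gx]].
  exists (G `|` segment x y); split.
  - by apply: compactU => //; exact: compact_seg.
  - apply: connectedU => //; last exact: connected_seg.
    by exists x; split=> //; exact: segment_l.
  - by move=> w [/GS//|]; exact: SF.
  - by left.
  - by right; exact: segment_r.
by split; apply: ext => //; exact: sq_center.
Qed.

End Convex.

(** * Vanishing of the first cohomology of a closed convex set *)

Section Twist.
Context {R : realType}.
Implicit Types (x y z n : plane R) (A B F M O P S : set (plane R)).
Implicit Types chi V h : plane R -> bool.

(** A colouring h with values in Z/2 whose local variation is that of chi where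
    V = 1, and zero where V = 0.  The product V * d(chi) is a 1-cocycle as soon
    as chi or V is locally constant at each point, and h is a primitive of it. *)
Definition twist chi V h A := forall p, A p ->
  \forall x \near p, A x -> h x (+) h p = V p && (chi x (+) chi p).

Definition twistable chi V A := exists h, twist chi V h A.

Lemma twist_sub chi V h A B : A `<=` B -> twist chi V h B -> twist chi V h A.
Proof. by move=> AB tB p /AB/tB; apply: filterS => x h1 /AB. Qed.

Lemma twistable_sub chi V A B : A `<=` B -> twistable chi V B -> twistable chi V A.
Proof. by move=> AB [h hB]; exists h; exact: twist_sub hB. Qed.

(** Two primitives of the same cocycle differ by a locally constant function. *)
Lemma twist_unique chi V h1 h2 A : connected A -> twist chi V h1 A ->
  twist chi V h2 A -> forall x y, A x -> A y -> h1 x (+) h2 x = h1 y (+) h2 y.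
Proof.
move=> cA t1 t2; apply: (loc_const_connected cA) => p Ap.
have := t1 p Ap; have := t2 p Ap; apply: filterS2 => x e2 e1 Ax.
by move: (e1 Ax); rewrite -(e2 Ax); move: (h1 x) (h1 p) (h2 x) (h2 p) => [] [] [] [].
Qed.

(** The Mayer-Vietoris step: two primitives differ by a constant on the
    connected intersection, so that one of them can be corrected. *)
Lemma twistable_glue chi V A B : closed A -> closed B -> connected (A `&` B) ->
  twistable chi V A -> twistable chi V B -> twistable chi V (A `|` B).
Proof.
move=> cA cB cAB [h1 t1] [h2 t2].
have [c hc] : exists c, forall q, A q -> B q -> h1 q = h2 q (+) c.
  have [AB0|/set0P[q [Aq Bq]]] := eqVneq (A `&` B) set0.
    by exists false => q Aq Bq; exfalso; rewrite -[False]/(set0 q) -AB0.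
  exists (h1 q (+) h2 q) => r Ar Br.
  have := twist_unique cAB (twist_sub (@subIsetl _ _ _) t1)
    (twist_sub (@subIsetr _ _ _) t2) (conj Aq Bq) (conj Ar Br).
  by move: (h1 q) (h1 r) (h2 q) (h2 r) => [] [] [] [].
pose g x := if `[<A x>] then h1 x else h2 x (+) c.
have gA x : A x -> g x = h1 x by move=> /asboolP; rewrite /g => ->.
have gB x : B x -> g x = h2 x (+) c.
  by move=> Bx; rewrite /g; case: asboolP => // Ax; exact: hc.
have bb (a b d : bool) : (a (+) d) (+) (b (+) d) = a (+) b by case: a b d => [] [] [].
exists g => p ABp.
have [Ap|nAp] := pselect (A p); have [Bp|nBp] := pselect (B p); last by case: ABp.
- have := t1 p Ap; have := t2 p Bp; apply: filterS2 => x h2x h1x [Ax|Bx].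
    by rewrite !gA//; exact: h1x.
  by rewrite !gB// bb; exact: h2x.
- have := t1 p Ap; have := near_notin cB nBp; apply: filterS2 => x nBx h1x [Ax|//].
  by rewrite !gA//; exact: h1x.
- have := t2 p Bp; have := near_notin cA nAp; apply: filterS2 => x nAx h2x [//|Bx].
  by rewrite !gB// bb; exact: h2x.
Qed.

(** The set of t such that Q a t is open and closed in [a, b]. *)
Lemma interval_ind (Q : R -> R -> Prop) :
  (forall a b c, a <= b -> b <= c -> Q a b -> Q b c -> Q a c) ->
  (forall a b c, a <= b -> b <= c -> Q a c -> Q a b) ->
  (forall x : R, exists2 e : R, 0 < e & forall s t, x - e < s -> s <= t -> t < x + e -> Q s
    t) ->
  forall a b, a <= b -> Q a b.
Proof.
move=> Qg Qm Ql a b ab.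
suff : forall t, `[a, b]%classic t -> Q a t by apply; rewrite /= in_itv /= lexx ab.
move=> t abt; apply: (connected_ind (A := `[a, b]%classic) (Pr := Q a) _ _ _ abt (x := a)).
- exact: segment_connected.
- move=> p; rewrite /= in_itv /= => /andP[ap pb].
  have [e e0 he] := Ql p; have : nbhs p (ball p e) by exact: nbhsx_ballx.
  apply: filterS => {abt}t; rewrite /ball /= ltr_distlC => /andP[t1 t2].
  rewrite in_itv /= => /andP[at_ tb]; case: (leP t p) => tp; split=> h.
  + apply: Qg h _ => //; apply: he => //; lra.
  + exact: Qm h.
  + by apply: Qm h => //; exact: ltW.
  + apply: Qg h _ => //; [exact: ltW|]; apply: he => //; [lra|exact: ltW].
- by rewrite /= in_itv /= lexx.
- have [e e0 he] := Ql a; apply: he; lra.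
Qed.

Section Domain.
Context (S : set (plane R)) (clS : closed S) (coS : convex S).
Context (chi V : plane R -> bool).
Hypothesis chiV : forall p, S p ->
  (\forall x \near p, S x -> chi x = chi p) \/ (\forall x \near p, S x -> V x = V p).

(** Near p, if chi is constant then zero is a primitive; if V is constant then
    V p && chi is one. *)
Lemma twistable_local p : exists2 e, 0 < e & twistable chi V (S `&` sq p e).
Proof.
have [Sp|nSp] := pselect (S p); last first.
  have := near_notin clS nSp.
  move=> /nbhs_sq[e e0 h]; exists e => //; exists (fun=> false) => q [Sq /h]; exact.
case: (chiV Sp) => /nbhs_sq[e e0 h]; exists e => //.
  exists (fun=> false) => q [Sq pq]; near=> x => -[Sx px].
  by rewrite h// [chi q]h//; case: (V q) (chi p) => [] [].
exists (fun x => V p && chi x) => q [Sq pq]; near=> x => -[Sx px].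
by rewrite [V q]h//; case: (V p).
Unshelve. all: by end_near. Qed.

(** Rectangles are exhausted by gluing in the vertical direction, over an
    interval of abscissae whose length is kept positive along the way, and then
    in the horizontal direction. *)
Lemma twistable_rect a b c d : a <= b -> c <= d -> twistable chi V (S `&` rect a b c d).
Proof.
move=> ab cd.
have cl r t u v : closed (S `&` rect r t u v) by apply: closedI => //; exact: closed_rect.
have co A B : convex A -> convex B -> connected ((S `&` A) `&` (S `&` B)).
  by move=> cA cB; apply: convex_connected; do 2?apply: convexI => //; apply: convexI.
apply: (interval_ind (Q := fun a b => twistable chi V (S `&` rect a b c d))) ab.
- move=> {}a b' {}b ab' bb' t1 t2; apply: twistable_sub (twistable_glue (cl _ _ _ _) (cl _
  _ _ _) (co _ _ _ _) t1 t2); try exact: convex_rect.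
  move=> z [Sz [z1 z2 z3 z4]]; case: (leP (complex.Re z) b') => zb; [left|right]; split=>
    //; split=> //; exact: ltW.
- move=> {}a b' {}b ab' bb'; apply: twistable_sub => z [Sz [z1 z2 z3 z4]].
  by split=> //; split=> //; exact: le_trans bb'.
move=> x.
pose Q c d := exists2 e, 0 < e & twistable chi V (S `&` rect (x - e) (x + e) c d).
suff [e e0 te] : Q c d.
  exists e => // s t xs st tx; apply: twistable_sub te => z [Sz [z1 z2 z3 z4]].
  split=> //; split=> //; lra.
apply: (interval_ind (Q := Q)) cd.
- move=> {}c b' {}d cb' bd' [e1 e10 t1] [e2 e20 t2].
  exists (Num.min e1 e2); first by rewrite lt_min e10.
  apply: twistable_sub (twistable_glue (cl _ _ _ _) (cl _ _ _ _) (co _ _ _ _) t1 t2); try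
    exact: convex_rect.
  have m1 : Num.min e1 e2 <= e1 by rewrite ge_min lexx.
  have m2 : Num.min e1 e2 <= e2 by rewrite ge_min lexx orbT.
  move=> z [Sz [z1 z2 z3 z4]]; case: (leP (complex.Im z) b') => zb; [left|right]; split=>
    //; split=> //; lra.
- move=> {}c b' {}d cb' bd' [e e0 te]; exists e => //.
  apply: twistable_sub te => z [Sz [z1 z2 z3 z4]].
  by split=> //; split=> //; exact: le_trans bd'.
move=> y; have [e e0 te] := twistable_local (x +i* y).
exists e => // s t ys st ty; exists (e / 2); first by rewrite divr_gt0.
apply: twistable_sub te => z [Sz [z1 z2 z3 z4]]; split=> //.
split; rewrite /= ltr_distl; apply/andP; split; lra.
Qed.

(** The set may be unbounded.  Primitives on increasing squares, normalized to
    vanish at a base point, agree on their common domain. *)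
Lemma twistable_convex : twistable chi V S.
Proof.
have [->|/set0P[p0 Sp0]] := eqVneq S set0; first by exists (fun=> false) => p [].
pose D (n : nat) := S `&` rect (- n%:R) n%:R (- n%:R) n%:R.
have cD (n : nat) : connected (D n).
  by apply: convex_connected; apply: convexI => //; exact: convex_rect.
have DS (m n : nat) : (m <= n)%N -> D m `<=` D n.
  rewrite -(ler_nat R) => mn z [Sz [z1 z2 z3 z4]]; split=> //; split; lra.
have /choice[H tH] : forall n : nat, exists h, twist chi V h (D n).
  by move=> n; apply: twistable_rect; rewrite ge0_cp.
pose N z : nat := (Num.truncn (`|complex.Re z| + `|complex.Im z|)).+1.
have DN z : S z -> sq z 1 `&` S `<=` D (N z).+1.
  move=> Sz w [[w1 w2] Sw]; split=> //.
  have := truncnS_gt (`|complex.Re z| + `|complex.Im z|); rewrite -/(N z) => h.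
  have h1 : `|complex.Re w| < (N z).+1%:R.
    rewrite -(subrK (complex.Re z) (complex.Re w)) (le_lt_trans (ler_normD _ _))// -natr1.
    have := normr_ge0 (complex.Im z); lra.
  have h2 : `|complex.Im w| < (N z).+1%:R.
    rewrite -(subrK (complex.Im z) (complex.Im w)) (le_lt_trans (ler_normD _ _))// -natr1.
    have := normr_ge0 (complex.Re z); lra.
  move: h1 h2; rewrite !ltr_norml => /andP[? ?] /andP[? ?]; split; exact: ltW.
have DNz z : S z -> D (N z).+1 z.
  by move=> Sz; apply: DN => //; split=> //; exact: sq_center.
pose g (n : nat) z := H n z (+) H n p0.
have gE (m n : nat) z : D m z -> D m p0 -> D n z -> D n p0 -> g m z = g n z.
  wlog mn : m n / (m <= n)%N => [wl|] Dm Dm0 Dn Dn0.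
    by have /orP[] := leq_total m n => mn; [|apply/esym]; exact: wl.
  have := twist_unique (cD m) (tH m) (twist_sub (DS _ _ mn) (tH n)) Dm Dm0.
  by rewrite /g; move: (H m z) (H m p0) (H n z) (H n p0) => [] [] [] [].
pose m z := maxn (N z).+1 (N p0).+1.
have Dm z : S z -> D (m z) z by move=> Sz; apply: DS (DNz z Sz); exact: leq_maxl.
have Dm0 z : D (m z) p0 by apply: DS (DNz p0 Sp0); exact: leq_maxr.
exists (fun z => g (m z) z) => p Sp.
have := tH (m p) p (Dm p Sp).
have := near_in (@open_sq R p 1) (sq_center p ltr01).
apply: filterS2 => x px tx Sx.
have Dx : D (m p) x by apply: DS (DN p Sp x _) => //; exact: leq_maxl.
rewrite (gE (m x) (m p) x)//; last exact: Dm.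
by rewrite -tx// /g; move: (H (m p) x) (H (m p) p) (H (m p) p0) => [] [] [].
Qed.
End Domain.
End Twist.

(** * Separation by a single component *)

Section Separation.
Context {R : realType}.
Implicit Types (x y z n p u v : plane R) (A B F G M O P S Z : set (plane R)).
Implicit Types chi V h : plane R -> bool.

Definition indic A : plane R -> bool := fun x => `[< A x >].

Lemma indic_eq A x y : (A x <-> A y) -> indic A x = indic A y.
Proof. exact: asbool_equiv_eq. Qed.

Lemma indicT A x : A x -> indic A x = true.
Proof. by move=> Ax; apply/asboolP. Qed.

Lemma indicF A x : ~ A x -> indic A x = false.
Proof. by move=> nAx; apply/asboolP. Qed.

Lemma twist_setU chi h1 h2 A B S : A `&` B = set0 ->
  twist chi (indic A) h1 S -> twist chi (indic B) h2 S ->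
  twist chi (indic (A `|` B)) (fun x => h1 x (+) h2 x) S.
Proof.
move=> AB t1 t2 p Sp; have := t1 p Sp; have := t2 p Sp.
apply: filterS2 => x h2x h1x Sx; move: (h1x Sx) (h2x Sx).
have -> : indic (A `|` B) p = indic A p || indic B p by exact: asbool_or.
have : indic A p && indic B p = false.
  by rewrite -asbool_and; apply/asboolP => ABp; rewrite -[False]/(set0 p) -AB.
by move: (indic A p) (indic B p) (h1 x) (h1 p) (h2 x) (h2 p) (chi x) (chi p)
  => [] [] [] [] [] [] [] [].
Qed.

(** The primitives of disjoint pieces add up, and the stability of the pieces
    under difference makes a finite cover of Z disjoint.  The sum then has the
    same variation as chi everywhere; it takes the same value at x and y, since
    the primitive of each piece does, and so does chi. *)
Lemma twist_cover S chi Z (Pc : set (set (plane R))) x y : connected S -> S x -> S y ->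
  compact Z ->
  (forall p, S p -> ~ Z p -> \forall z \near p, S z -> chi z = chi p) ->
  (forall A B, Pc A -> Pc B -> Pc (A `\` B)) ->
  (forall A, Pc A -> exists2 h, twist chi (indic A) h S & h x = h y) ->
  (forall z, Z z -> exists2 A, Pc A & \forall w \near z, Z w -> A w) ->
  chi x = chi y.
Proof.
move=> cS Sx Sy cZ chiZ PcD Pch cov.
pose good G := (exists2 h, twist chi (indic G) h S & h x = h y) /\
  forall A, Pc A -> Pc (A `\` G).
have good0 : good set0.
  split; last by move=> A; rewrite setD0.
  exists (fun=> false) => // p Sp; apply: near_all => z _.
  by rewrite indicF.
have goodU G A : good G -> Pc A -> good (G `|` A).
  move=> [[h1 t1 e1] hG] PA; split; last by move=> B PB; rewrite -setDDl; apply: PcD => //;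
    exact: hG.
  have [h2 t2 e2] := Pch _ (hG _ PA).
  exists (fun x => h1 x (+) h2 x); last by rewrite e1 e2.
  have -> : G `|` A = G `|` (A `\` G).
    by rewrite setUDr setDv setD0.
  apply: twist_setU => //; by rewrite setDIK.
have [G [[h th hxy] _] ZG] : exists2 G, good G & Z `<=` G.
  suff /(_ set0 good0)[G gG [_ ZG]] : forall G, good G -> exists2 G', good G' & G `<=` G'
    /\ Z `<=` G'.
    by exists G.
  apply: (compact_ind (Pr := fun Z => forall G, good G -> exists2 G', good G' & G `<=` G'
    /\ Z `<=` G') cZ).
  - by move=> G gG; exists G => //; split=> //; exact: sub0set.
  - move=> A B AB hB G gG; have [G' gG' [GG' BG']] := hB G gG.
    by exists G' => //; split=> //; exact: subset_trans BG'.
  - move=> A B hA hB G gG; have [G1 gG1 [GG1 AG1]] := hA G gG.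
    have [G2 gG2 [GG2 BG2]] := hB G1 gG1; exists G2 => //; split.
      exact: subset_trans GG2.
    by move=> z [/AG1/GG2|/BG2].
  - move=> z Zz; have [A PA nA] := cov z Zz.
    exists [set w | Z w -> A w] => //.
    move=> G gG; exists (G `|` A); first exact: goodU.
    by split=> [w Gw|w [Zw /(_ Zw) Aw]]; [left|right].
have : h x (+) chi x = h y (+) chi y.
  apply: (@loc_const_connected _ _ (fun x => h x (+) chi x) S) => // p Sp.
  have [Zp|nZp] := pselect (Z p).
    apply: filterS (th p Sp) => z tz Sz; have := tz Sz.
    rewrite indicT; last exact: ZG.
    by move: (h z) (h p) (chi z) (chi p) => [] [] [] [].
  have := th p Sp; have := chiZ p Sp nZp.
  apply: filterS2 => z cz tz Sz; have := tz Sz; rewrite cz// addbb andbF.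
  by move: (h z) (h p) (chi p) => [] [] [].
by rewrite hxy; move: (h y) (chi x) (chi y) => [] [] [].
Qed.

Lemma twist_zero chi V h A B x y : twist chi V h A -> B `<=` A -> connected B ->
  (forall z, B z -> V z = false) -> B x -> B y -> h x = h y.
Proof.
move=> th BA cB BV; apply: (loc_const_connected cB) => p Bp.
have := th p (BA _ Bp); apply: filterS => z hz Bz; have := hz (BA _ Bz).
by rewrite BV// andFb; move: (h z) (h p) => [] [].
Qed.

(** With chi the indicator of the component of u in S `\` F, the pieces are the
    clopen subsets N of F that do not separate u from v.  If no component of F
    separates them, each component has such a clopen neighbourhood, namely one
    that avoids a compact connected set joining u to v. *)
Lemma separation_component S F u v : closed S -> convex S -> compact F -> F `<=` S ->
  (S `\` F) u -> (S `\` F) v ->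
  (forall q, F q -> connected_component (S `\` connected_component F q) u v) ->
  connected_component (S `\` F) u v.
Proof.
move=> clS coS cF FS Su Sv sepQ; have clF := plane_compact_closed cF.
pose chi := indic (connected_component (S `\` F) u).
have chiF p : S p -> ~ F p -> \forall z \near p, S z -> chi z = chi p.
  move=> Sp nFp; have := component_near u coS clF (conj Sp nFp).
  by apply: filterS => z + Sz => /(_ Sz)[_ ?]; exact: indic_eq.
suff : chi u = chi v.
  rewrite /chi indicT; last exact: connected_component_refl.
  by move=> /esym/asboolP.
apply: (twist_cover (Z := F) (S := S)
  (Pc := [set N | clopen_in F N /\
    exists G, [/\ connected G, G `<=` S `\` N, G u & G v]])) => //.
- exact: convex_connected.
- by case: Su.
- by case: Sv.
- move=> A B [hA [G [cG GA Gu Gv]]] [hB _]; split.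
    rewrite (_ : A `\` B = A `&` (F `\` B)); last by rewrite setIDA (setIidl _)//; case: hA.
    by apply: clopen_inI => //; exact: clopen_inC.
  by exists G; split=> // z /GA[Sz nAz]; split=> // -[].
- move=> N [[cN cN' NF] [G [cG GA Gu Gv]]].
  have [|O1 [O2 [oO1 oO2 NO1 NO2 O12]]] := plane_normal cN cN'.
    by rewrite setDIK.
  have O12' z : O1 z -> O2 z -> False by move=> ? ?; rewrite -[False]/(set0 z) -O12.
  have [p Sp|h th] := @twistable_convex R S clS coS chi (indic O1).
    have [O1p|nO1p] := pselect (O1 p).
      right; have := near_in oO1 O1p; apply: filterS => z O1z _.
      by rewrite !indicT.
    have [Fp|nFp] := pselect (F p); last by left; exact: chiF.
    have O2p : O2 p by apply: NO2; split=> // /NO1.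
    right; have := near_in oO2 O2p; apply: filterS => z O2z _.
    by rewrite !indicF// => /O12'; exact.
  (* On F the sets N and O1 agree, and elsewhere chi is locally constant. *)
  have th' : twist chi (indic N) h S.
    move=> p Sp; have [Fp|nFp] := pselect (F p).
      have -> : indic N p = indic O1 p.
        apply: asbool_equiv_eq; split; first exact: NO1.
        by move=> O1p; apply: contrapT => nNp; apply: (O12' p) => //; exact: NO2.
      exact: th.
    have := chiF p Sp nFp; have := th p Sp; apply: filterS2 => z tz cz Sz.
    by rewrite tz// cz// addbb !andbF.
  exists h => //; apply: (twist_zero th') Gu Gv => //.
    by move=> z /GA[].
  by move=> z /GA[_ ?]; rewrite indicF.
- move=> z Fz.
  have [|||G [cG coG GS Gu Gv]] := @component_arc R S (connected_component F z) u v coS.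
  + exact: component_closed.
  + by case: Su => Su nFu; split=> // /connected_component_sub.
  + exact: sepQ.
  have [||N [hN Nz NG]] := @component_split R F z G cF Fz.
  + exact: plane_compact_closed.
  + by apply/seteqP; split=> // w [/GS[_ ?]].
  exists N.
    split=> //; exists G; split=> // w Gw; split; first by case: (GS _ Gw).
    by move=> Nw; rewrite -[False]/(set0 w) -NG.
  have [cN cN' _] := hN; have := near_notin cN' (_ : ~ (F `\` N) z).
  move=> /(_ (fun e => e.2 Nz)); apply: filterS => w nw Fw.
  by apply: contrapT => nNw; exact: nw.
Qed.

Lemma compact_sub_sq F : compact F -> exists2 m, 0 <= m & F `<=` sq 0 m.
Proof.
move=> cF; apply: (compact_ind (Pr := fun F => exists2 m, 0 <= m & F `<=` sq 0 m) cF).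
- by exists 0.
- by move=> A B AB [m m0 Bm]; exists m => //; exact: subset_trans Bm.
- move=> A B [m m0 Am] [k k0 Bk]; exists (Num.max m k); first by rewrite le_max m0.
  by move=> z [/Am|/Bk] [h1 h2]; split; rewrite lt_max ?h1 ?h2 ?orbT.
- move=> x _; exists (sq x 1); first by apply: near_in; [exact: open_sq|exact: sq_center].
  exists (`|complex.Re x| + `|complex.Im x| + 1); first by rewrite !addr_ge0.
  move=> z [_ [h1 h2]]; rewrite /sq /= !subr0.
  have := normr_ge0 (complex.Re x); have := normr_ge0 (complex.Im x).
  have := ler_normD (complex.Re z - complex.Re x) (complex.Re x).
  have := ler_normD (complex.Im z - complex.Im x) (complex.Im x).
  by rewrite !subrK => *; split; lra.
Qed.

(** The dual of separation_component.  Here F is cut into two clopen parts, chi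
    is the indicator of an open set around the part containing x, and the pieces
    are the components of S `\` F: finitely many of them cover the compact set
    where chi is not locally constant. *)
Lemma separation_gap S F x y : closed S -> convex S -> compact F -> F `<=` S ->
  F x -> F y -> ~ connected_component F x y ->
  exists2 p, (S `\` F) p &
    ~ connected_component (S `\` connected_component (S `\` F) p) x y.
Proof.
move=> clS coS cF FS Fx Fy nxy; have clF := plane_compact_closed cF.
apply: contrapT => nsep.
have sep p : (S `\` F) p -> connected_component (S `\` connected_component (S `\` F) p) x y.
  by move=> Sp; apply: contrapT => h; apply: nsep; exists p.
have [||A [[cA cA' AF] Ax Ay]] := @component_split R F x [set y] cF Fx.
- by apply: plane_compact_closed; exact: compact_set1.
- by apply/seteqP; split=> // z [->].
have [|O1 [O2 [oO1 oO2 NO1 NO2 O12]]] := plane_normal cA cA'.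
  by rewrite setDIK.
have O12' z : O1 z -> O2 z -> False by move=> ? ?; rewrite -[False]/(set0 z) -O12.
have [m m0 Fm] := compact_sub_sq cF.
(* Intersecting with a square containing F confines the variation of chi to
   the compact rectangle B. *)
pose N := O1 `&` sq 0 m; pose B := rect (- m) m (- m) m.
have oN : open N by apply: openI => //; exact: open_sq.
have NB : N `<=` B.
  move=> z [_ []]; rewrite !subr0 !ltr_norml => /andP[? ?] /andP[? ?].
  by split; exact: ltW.
have nB p : ~ B p -> \forall z \near p, indic N z = indic N p.
  move=> nBp; have := near_notin (@closed_rect R _ _ _ _) nBp.
  by apply: filterS => z nBz; rewrite !indicF// => /NB.
pose Z := (S `&` B) `\` (N `|` O2).
have chiZ p : S p -> ~ Z p -> \forall z \near p, S z -> indic N z = indic N p.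
  move=> Sp nZp.
  have [Np|nNp] := pselect (N p).
    by have := near_in oN Np; apply: filterS => z Nz _; rewrite !indicT.
  have [O2p|nO2p] := pselect (O2 p).
    have := near_in oO2 O2p; apply: filterS => z O2z _.
    by rewrite !indicF// => -[/O12' h _]; exact: h.
  have nBp : ~ B p by move=> Bp; apply: nZp; split=> // -[].
  by have := nB p nBp; apply: filterS.
have FN : F `<=` N `|` O2.
  move=> p Fp; have [Ap|nAp] := pselect (A p); last by right; exact: NO2.
  by left; split; [exact: NO1|exact: Fm].
have ZF p : Z p -> ~ F p by move=> [_ h] /FN.
suff : indic N x = indic N y.
  rewrite indicT; last by split; [exact: NO1|exact: Fm].
  rewrite indicF// => -[O1y _]; apply: (O12' y) => //; apply: NO2; split=> // Ay'.
  by rewrite -[False]/(set0 y) -Ay.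
apply: (twist_cover (Z := Z) (S := S)
  (Pc := [set U | U = set0 \/ exists2 p, (S `\` F) p & U = connected_component (S `\` F)
    p])) => //.
- exact: convex_connected.
- exact: FS.
- exact: FS.
- apply: (@subclosed_compact _ _ B) => //; last by move=> z [[]].
    apply: closedI; first by apply: closedI => //; exact: closed_rect.
    by apply: open_closedC; exact: openU.
  exact: compact_rect.
- move=> U U' [->|[p Sp ->]]; first by rewrite set0D; left.
  move=> [->|[q Sq ->]]; first by rewrite setD0; right; exists p.
  have [/same_connected_component ->|npq] := pselect (connected_component (S `\` F) p q).
    by rewrite setDv; left.
  right; exists p => //; apply/seteqP; split=> z; first by case.
  move=> pz; split=> // qz; apply: npq; apply: connected_component_trans pz _.
  exact: connected_component_sym.
- move=> U [->|[p Sp UE]].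
    exists (fun=> false) => // q _; apply: near_all => z _; by rewrite indicF.
  have [q Sq|h th] := @twistable_convex R S clS coS (indic N) (indic U).
    have [Fq|nFq] := pselect (F q); first by left; apply: chiZ => // -[_]; apply; exact: FN.
    right; have := component_near p coS clF (conj Sq nFq).
    by apply: filterS => z + Sz => /(_ Sz)[_ ?]; rewrite UE; exact: indic_eq.
  exists h => //.
  apply: (twist_zero (B := connected_component (S `\` U) x) th).
  + by move=> z /connected_component_sub[].
  + exact: component_connected.
  + by move=> z /connected_component_sub[_ ?]; rewrite indicF.
  + apply: connected_component_refl; split; first exact: FS.
    by rewrite UE => /connected_component_sub[].
  + by rewrite UE; exact: sep.
- move=> z Zz; have Sz : (S `\` F) z by split; [by case: Zz => -[]|exact: ZF].
  exists (connected_component (S `\` F) z); first by right; exists z.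
  have := component_near z coS clF Sz; apply: filterS => w h [[Sw _] _].
  by apply/(h Sw).2; exact: connected_component_refl.
Qed.

End Separation.

(** * The linking lemma *)

Section Linking.
Context {R : realType}.
Implicit Types (x y z n u v e : plane R) (A B C E F G M O P S V Z : set (plane R)).
Implicit Types (i j k l m : nat) (p q : nat -> plane R).

(** The chain is constant after its last index, so that it can be indexed by all
    natural numbers. *)
Lemma chain C (rho : plane R -> plane R -> Prop) x y : connected C ->
  (forall z, C z -> \forall w \near z, C w -> rho z w /\ rho w z) ->
  C x -> C y -> exists k p, [/\ p 0%N = x, forall i, (k <= i)%N -> p i = y &
    forall i, C (p i) /\ rho (p i) (p i.+1)].
Proof.
move=> cC hr Cx Cy.
pose Pr y := exists k p, [/\ p 0%N = x, forall i, (k <= i)%N -> p i = y &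
    forall i, C (p i) /\ rho (p i) (p i.+1)].
have refl z : C z -> rho z z.
  by move=> Cz; have [] := nbhs_singleton (hr z Cz) Cz.
have ext z w : C z -> C w -> rho z w -> Pr z -> Pr w.
  move=> Cz Cw zw [k [p [p0 pk pC]]].
  exists k.+1, (fun i => if (i <= k)%N then p i else w); split=> //.
    by move=> i ki; rewrite leqNgt ki.
  move=> i; case: (ltngtP i k) => [ik|ki|->].
  - by rewrite ?(ltnW ik); exact: pC.
  - by split=> //; exact: refl.
  - by rewrite pk//.
apply: (connected_ind (Pr := Pr) cC _ Cx Cy); last first.
  by exists 0%N, (fun=> x); split=> // i; split=> //; exact: refl.
move=> z Cz; apply: filterS (hr z Cz) => w h Cw; have [zw wz] := h Cw.
by split; exact: ext.
Qed.

Context (a b : plane R -> R) (ab : coords a b).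

(** The sup norm in the given coordinates: where it is attained, the
    corresponding coordinate keeps its sign under smaller perturbations. *)
Definition nrm z : R := Num.max `|a z| `|b z|.

Let aB x y : a (x - y) = a x - a y. Proof. by case: ab. Qed.
Let bB x y : b (x - y) = b x - b y. Proof. by case: ab. Qed.

Lemma nrmC x y : nrm (x - y) = nrm (y - x).
Proof. by rewrite /nrm !aB !bB distrC [in X in Num.max _ X]distrC. Qed.

Lemma nrm_ge0 x : 0 <= nrm x.
Proof. by rewrite le_max normr_ge0. Qed.

Lemma nrm_tri x y z : nrm (x - z) <= nrm (x - y) + nrm (y - z).
Proof.
rewrite /nrm !aB !bB ge_max; apply/andP; split.
  have := ler_distD (a y) (a x) (a z) => /le_trans; apply.
  by apply: lerD; rewrite le_max lexx.
have := ler_distD (b y) (b x) (b z) => /le_trans; apply.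
by apply: lerD; rewrite le_max lexx orbT.
Qed.

Lemma nbhs_nrm x A : nbhs x A <-> exists2 d, 0 < d & forall y, nrm (y - x) < d -> A y.
Proof.
case: ab => _ _ ->; split=> -[d d0 h]; exists d => // y.
  by rewrite /nrm aB bB gt_max => /andP[]; exact: h.
by move=> h1 h2; apply: h; rewrite /nrm aB bB gt_max h1.
Qed.

(** Since only V is closed, the distance from E to V may be zero.  The steps in E
    are therefore taken small relative to the distance from the current point to
    V; once this finite chain is chosen, the steps in V can be taken uniformly
    small. *)
Lemma two_chains_closed E V e1 e2 v1 v2 : connected E -> connected V -> closed V ->
  E `&` V = set0 -> E e1 -> E e2 -> V v1 -> V v2 ->
  exists k l p q, [/\ p 0%N = e1, p k = e2, q 0%N = v1 & q l = v2] /\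
   [/\ forall i, E (p i), forall j, V (q j) & forall i j, (i <= k)%N ->
    nrm (p i.+1 - p i) + nrm (q j.+1 - q j) < nrm (p i - q j)].
Proof.
move=> cE cV clV EV Ee1 Ee2 Vv1 Vv2.
(* The factor 2 leaves a margin for the steps of the other chain. *)
pose rho x y := exists2 d, 2 * nrm (y - x) < d & forall v, V v -> d <= nrm (x - v).
have [|k [p [p0 pk pC]]] := @chain E rho e1 e2 cE _ Ee1 Ee2.
  move=> x Ex.
  have nVx : ~ V x by move=> Vx; rewrite -[False]/(set0 x) -EV.
  have := near_notin clV nVx.
  move=> /nbhs_nrm[d d0 dV]; apply/nbhs_nrm.
  have dx v : V v -> d <= nrm (x - v).
    by move=> Vv; rewrite leNgt nrmC; apply/negP => /dV.
  exists (d / 4); first by rewrite divr_gt0.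
  move=> y xy Ey; split; first by exists d => //; lra.
  exists (d * 3 / 4); first by rewrite nrmC; lra.
  by move=> v /dx; have := nrm_tri x y v; rewrite [nrm (x - y)]nrmC; lra.
have [eta eta0 heta] : exists2 eta, 0 < eta & forall i, (i <= k)%N -> forall v, V v ->
    nrm (p i.+1 - p i) + eta <= nrm (p i - v).
  elim: (k) => [|m [eta eta0 IH]].
    have [_ [d d1 d2]] := pC 0%N; exists (d / 2).
      by have := nrm_ge0 (p 1%N - p 0%N); lra.
    move=> i; rewrite leqn0 => /eqP-> v /d2; lra.
  have [_ [d d1 d2]] := pC m.+1; exists (Num.min eta (d / 2)).
    by have := nrm_ge0 (p m.+2 - p m.+1); rewrite lt_min eta0 /=; lra.
  have m1 : Num.min eta (d / 2) <= eta by rewrite ge_min lexx.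
  have m2 : Num.min eta (d / 2) <= d / 2 by rewrite ge_min lexx orbT.
  move=> i; rewrite leq_eqVlt => /orP[/eqP-> v /d2|im v Vv]; first lra.
  have := IH i im v Vv; lra.
have [|l [q [q0 ql qC]]] := @chain V (fun x y => nrm (y - x) < eta) v1 v2 cV _ Vv1 Vv2.
  move=> x Vx; apply/nbhs_nrm; exists eta => // y xy _.
  by rewrite [X in _ /\ X < _]nrmC.
exists k, l, p, q; split; split=> //; [exact: pk|exact: ql| | |].
- by move=> i; case: (pC i).
- by move=> j; case: (qC j).
- move=> i j ik; apply: lt_le_trans (heta i ik (q j) _); last by case: (qC j).
  by rewrite ltrD2l; case: (qC j).
Qed.

Lemma two_chains E V e1 e2 v1 v2 : connected E -> connected V ->
  closed E \/ closed V -> E `&` V = set0 -> E e1 -> E e2 -> V v1 -> V v2 ->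
  exists k l p q, [/\ p 0%N = e1, p k = e2, q 0%N = v1 & q l = v2] /\
   [/\ forall i, E (p i), forall j, V (q j) & forall i j, (i <= k)%N -> (j <= l)%N ->
    nrm (p i.+1 - p i) + nrm (q j.+1 - q j) < nrm (p i - q j)].
Proof.
move=> cE cV [clE|clV] EV Ee1 Ee2 Vv1 Vv2; last first.
  have [k [l [p [q [h [pE qV hpq]]]]]] := two_chains_closed cE cV clV EV Ee1 Ee2 Vv1 Vv2.
  by exists k, l, p, q; split=> //; split=> // i j ik _; exact: hpq.
rewrite setIC in EV.
have [k [l [p [q [[h1 h2 h3 h4] [pE qV hpq]]]]]] := two_chains_closed cV cE clE EV Vv1 Vv2
  Ee1 Ee2.
exists l, k, q, p; split=> //; split=> // i j _ jk.
by rewrite addrC [ltRHS]nrmC; exact: hpq.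
Qed.

(** Along an edge in the half-plane b <= 0, or in a <= 0, the half-axis
    b >= 0, a = 0 counts no crossing: at b = 0 the coordinate a is too large to
    change its sign. *)
Lemma edge_zero x y : nrm (y - x) < nrm x -> b x <= 0 \/ (a x <= 0 /\ a y <= 0) ->
  (0 <= b x) && ((0 < a x) (+) (0 < a y)) = false.
Proof.
move=> xy [bx|[ax ay]]; last by rewrite !ltNge ax ay andbF.
have [b0|//] := boolP (0 <= b x).
have bx0 : b x = 0 by apply/eqP; rewrite eq_le bx.
move: xy; rewrite /nrm bx0 normr0 [X in _ < X]max_l// gt_max aB => /andP[h _].
apply/negbTE; rewrite negb_add; apply/eqP.
have [ax|ax] := ltP 0 (a x); [apply/esym/idP|apply/esym/negbTE; rewrite -leNgt].
  by move: h; rewrite (gtr0_norm ax) ltr_norml => /andP[]; lra.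
by move: h; rewrite (ler0_norm ax) ltr_norml => /andP[]; lra.
Qed.

Lemma sign_const x : forall (s t : R), s + t < nrm x ->
  (forall y, nrm (y - x) <= s + t -> (0 < a y) = (0 < a x)) \/
  (forall y, nrm (y - x) <= s + t -> (0 <= b y) = (0 <= b x)).
Proof.
move=> s t; rewrite /nrm lt_max => /orP[h|h]; [left|right] => y.
  rewrite ge_max aB => /andP[/le_lt_trans/(_ h) h1 _]; move: h1.
  have [ax|ax] := ltP 0 (a x).
    by rewrite (gtr0_norm ax) ltr_norml => /andP[? ?]; apply/idP; lra.
  by rewrite (ler0_norm ax) ltr_norml => /andP[? ?]; apply/negbTE; rewrite -leNgt; lra.
rewrite ge_max bB => /andP[_ /le_lt_trans/(_ h) h1]; move: h1.
have [ax|ax] := leP 0 (b x).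
  by rewrite (ger0_norm ax) ltr_norml => /andP[? ?]; apply/idP; lra.
by rewrite (ltr0_norm ax) ltr_norml => /andP[? ?]; apply/negbTE; rewrite -ltNge; lra.
Qed.

(** Following x - y for x in E and y in V along the boundary of the parameter
    rectangle: it stays in the half-plane b >= 0 on the side y = v1, going from
    a > 0 to a <= 0, and on each other side in b <= 0 or in a <= 0.  So it would
    turn once around the origin, which is impossible as it never vanishes on the
    rectangle.  The alternatives in the last two hypotheses serve both for two
    sets in a strip and for two sets in a rectangle. *)
Lemma linking E V e1 e2 v1 v2 : connected E -> connected V ->
  closed E \/ closed V -> E e1 -> E e2 -> V v1 -> V v2 ->
  0 < a (e1 - v1) -> a (e2 - v1) <= 0 ->
  (forall e, E e -> 0 <= b (e - v1)) ->
  (forall v, V v -> b (e1 - v) <= 0) ->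
  (forall v, V v -> b (e2 - v) <= 0) \/ (forall v, V v -> a (e2 - v) <= 0) ->
  (forall e, E e -> b (e - v2) <= 0) \/ (forall e, E e -> a (e - v2) <= 0) ->
  E `&` V !=set0.
Proof.
move=> cE cV clEV Ee1 Ee2 Vv1 Vv2 a1 a2 s0 s1 s2 s3.
apply/set0P/negP => /eqP EV.
have [k [l [p [q [[p0 pk q0 ql] [pE qV hpq]]]]]] := two_chains cE cV clEV EV Ee1 Ee2 Vv1 Vv2.
pose D i j := p i - q j.
pose W i j := 0 <= b (D i j).
pose X i j := 0 < a (D i j).
pose tH i j := W i j && (X i j (+) X i.+1 j).
pose tV i j := W i j && (X i j (+) X i j.+1).
have DH i j : D i.+1 j - D i j = p i.+1 - p i by rewrite /D opprB addrA subrK.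
have DV i j : nrm (D i j.+1 - D i j) = nrm (q j.+1 - q j).
  by rewrite [RHS]nrmC; congr nrm; rewrite /D opprB addrC addrA subrK.
(* The variation around a unit square of the grid vanishes, because one of
   the two coordinates keeps its sign on the whole square. *)
have square i j : (i < k)%N -> (j < l)%N -> tH i j (+) tH i j.+1 = tV i j (+) tV i.+1 j.
  move=> ik jl; have h := hpq i j (ltnW ik) (ltnW jl).
  have n1 : nrm (D i.+1 j - D i j) <= nrm (p i.+1 - p i) + nrm (q j.+1 - q j).
    by rewrite DH lerDl nrm_ge0.
  have n2 : nrm (D i j.+1 - D i j) <= nrm (p i.+1 - p i) + nrm (q j.+1 - q j).
    by rewrite DV lerDr nrm_ge0.
  have n3 : nrm (D i.+1 j.+1 - D i j) <= nrm (p i.+1 - p i) + nrm (q j.+1 - q j).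
    by apply: le_trans (nrm_tri _ (D i j.+1) _) _; rewrite DH DV.
  rewrite /tH /tV /W /X.
  case: (sign_const h) => c; rewrite -/(D i j) in c.
    by rewrite !c// !addbb !andbF.
  rewrite !c//; case: (0 <= b (D i j)) => //=.
  by move: (0 < a (D i j)) (0 < a (D i.+1 j)) (0 < a (D i j.+1)) (0 < a (D i.+1 j.+1)) =>
    [] [] [] [].
(* The sum along the j-th row does not depend on j, as the two lateral sides
   contribute nothing: it is 0 for j = l and 1 for j = 0. *)
pose s m j := \big[addb/false]_(i < m) tH i j.
have sS m j : s m.+1 j = s m j (+) tH m j by rewrite /s big_ord_recr.
have s0' j : s 0%N j = false by rewrite /s big_ord0.
have s_step m j : (m <= k)%N -> (j < l)%N -> s m j (+) s m j.+1 = tV 0%N j (+) tV m j.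
  move=> + jl; elim: m => [_|m IH mk]; first by rewrite !s0' addbb; case: (tV _ _).
  rewrite !sS; have := square m j mk jl; have := IH (ltnW mk).
  by move: (s m j) (s m j.+1) (tH m j) (tH m j.+1) (tV 0%N j) (tV m j) (tV m.+1 j)
    => [] [] [] [] [] [] [].
have eV i j : (i <= k)%N -> (j <= l)%N -> nrm (D i j.+1 - D i j) < nrm (D i j).
  move=> ik jl; rewrite DV; apply: le_lt_trans (hpq i j ik jl).
  by rewrite lerDr nrm_ge0.
have eH i j : (i <= k)%N -> (j <= l)%N -> nrm (D i.+1 j - D i j) < nrm (D i j).
  move=> ik jl; rewrite DH; apply: le_lt_trans (hpq i j ik jl).
  by rewrite lerDl nrm_ge0.
have tV0 j : (j <= l)%N -> tV 0%N j = false.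
  by move=> jl; apply: edge_zero; [exact: eV|left; rewrite /D p0; exact: s1].
have tVk j : (j <= l)%N -> tV k j = false.
  move=> jl; apply: edge_zero; first exact: eV.
  by rewrite /D pk; case: s2 => h; [left|right; split]; exact: h.
have tHl i : (i <= k)%N -> tH i l = false.
  move=> ik; apply: edge_zero; first exact: eH.
  by rewrite /D ql; case: s3 => h; [left|right; split]; exact: h.
have sk j : (j <= l)%N -> s k j = s k 0%N.
  elim: j => // j IH jl; rewrite -IH; last exact: ltnW.
  have := s_step k j (leqnn k) jl; rewrite tV0 ?tVk; try exact: ltnW.
  by move: (s k j) (s k j.+1) => [] [].
have skl : s k l = false.
  by rewrite /s big1// => i _; apply: tHl; exact: ltnW.
have sk0 m : s m 0%N = X 0%N 0%N (+) X m 0%N.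
  elim: m => [|m IH]; first by rewrite s0' addbb.
  rewrite sS IH /tH.
  have -> : W m 0%N by rewrite /W /D q0; exact: s0.
  by move: (X 0%N 0%N) (X m 0%N) (X m.+1 0%N) => [] [] [].
have := sk l (leqnn l); rewrite skl sk0 /X /D p0 q0 pk a1.
by rewrite ltNge a2.
Qed.

End Linking.

(** * Components that cross a strip *)

Lemma finite_no_three (T : Type) (X : set T) :
  (forall x y z, X x -> X y -> X z -> [\/ x = y, y = z | x = z]) -> finite_set X.
Proof.
move=> h; have [->|/set0P[x Xx]] := eqVneq X set0; first exact: finite_set0.
have [XE|/existsNP[y /not_implyP[Xy nyx]]] := pselect (forall y, X y -> y = x).
  by apply: (@sub_finite_set _ _ [set x]) => [y /XE|]; [|exact: finite_set1].
apply: (@sub_finite_set _ _ [set x; y]); last exact: finite_set2.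
move=> z Xz; case: (h x y z Xx Xy Xz) => e; [by exfalso; apply: nyx|by right|by left].
Qed.

(** By induction on I: the fibres of one of the functions fall under the
    induction hypothesis. *)
Lemma finite_separated (T : Type) (J : choiceType) (U : Type) (f : J -> T -> U) (I : set J)
    (X : set T) : finite_set I -> (forall i, I i -> finite_set (f i @` X)) ->
  (forall x y, X x -> X y -> (forall i, I i -> f i x = f i y) -> x = y) ->
  finite_set X.
Proof.
move=> /finite_seqP[s ->]; elim: s X => [|i s IH] X fX sepX.
  by apply: finite_no_three => x y z Xx Xy Xz; constructor 1; apply: sepX.
have -> : X = \bigcup_(u in f i @` X) (X `&` [set x | f i x = u]).
  apply/seteqP; split=> x; last by move=> [u _ []].
  by move=> Xx; exists (f i x) => //; exists x.
apply: bigcup_finite; first by apply: fX; rewrite /= mem_head.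
move=> u _; apply: IH.
  move=> j js; apply: (@sub_finite_set _ _ (f j @` X)); last first.
    by apply: fX; rewrite /= inE js orbT.
  by move=> _ [x [Xx _] <-]; exists x.
move=> x y [Xx /= xu] [Xy /= yu] h; apply: sepX => // j; rewrite /= inE => /orP[/eqP->|/h//].
by rewrite xu yu.
Qed.

Section Strips.
Context {R : realType}.
Implicit Types (x y z n u v w e : plane R) (A B C E F G M O P Q S V X Y Z : set (plane R)).

Lemma dot_continuous n : continuous (dot n).
Proof.
have [->|n0] := eqVneq n 0; last exact: (coords_continuous (coords_dot n0)).
have -> : dot (0 : plane R) = fun=> 0.
  by apply/funext => z; rewrite /dot /= !mul0r addr0.
exact: cst_continuous.
Qed.

Lemma dot_inj n x y : n != 0 -> dot n x = dot n y -> dot (n * 'i) x = dot (n * 'i) y -> x = y.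
Proof.
by move=> n0; exact: coords_inj (coords_dot n0).
Qed.

Definition strip n (c1 c2 : R) : set (plane R) := [set z | c1 <= dot n z <= c2].

Definition level n (c : R) : set (plane R) := [set z | dot n z = c].

Lemma closed_strip n c1 c2 : closed (strip n c1 c2).
Proof.
rewrite (_ : strip _ _ _ = [set z | c1 <= dot n z] `&` [set z | dot n z <= c2]).
  by apply: closedI; [apply: closed_superlevel|apply: closed_sublevel]; exact: dot_continuous.
by apply/seteqP; split=> z; [move=> /andP[]|move=> [? ?]; exact/andP].
Qed.

Lemma convex_strip n c1 c2 : convex (strip n c1 c2).
Proof.
move=> x y t /andP[? ?] /andP[? ?] t01; rewrite /strip /= dot_seg.
by apply/andP; split; [exact: conv_ge|exact: conv_le].
Qed.

Lemma convex_level n c : convex (level n c).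
Proof. by move=> x y t hx hy t01; rewrite /level /= dot_seg hx hy subrr mulr0 addr0. Qed.

Definition crosses n (c1 c2 : R) A := A `&` level n c1 !=set0 /\ A `&` level n c2 !=set0.

Definition crossing_components n c1 c2 X := [set A | is_component X A /\ crosses n c1 c2 A].

Section OneStrip.
Context (n : plane R) (n0 : n != 0) (c1 c2 : R) (c12 : c1 < c2).
Let S := strip n c1 c2.
Let a := dot (n * 'i).

Lemma level_strip c : c1 <= c <= c2 -> level n c `<=` S.
Proof. by move=> h z; rewrite /level /S /strip /= => ->. Qed.

(** Otherwise the segment from u to v would join them in S `\` E. *)
Lemma crossing_between E u v : (S `\` E) u -> (S `\` E) v ->
  dot n u = c1 -> dot n v = c1 -> ~ connected_component (S `\` E) u v ->
  a u <= a v -> exists e, [/\ E e, dot n e = c1 & a u < a e < a v].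
Proof.
move=> [Su nEu] [Sv nEv] du dv nuv auv.
have [t t01 Et] : exists2 t, 0 <= t <= 1 & E (seg u v t).
  apply: contrapT => nE; apply: nuv.
  apply: (connected_component_max (B := segment u v)); first exact: segment_l.
    move=> z uvz; split; first exact: (segmentP (convex_strip (n:=n) (c1:=c1) (c2:=c2)) Su Sv).
    by move: uvz => [t]; rewrite /= in_itv /= => t01 <- Ez; apply: nE; exists t.
  exact: connected_seg.
  exact: segment_r.
exists (seg u v t); split=> //; first by rewrite dot_seg du dv subrr mulr0 addr0.
have {auv}auv : a u < a v.
  rewrite lt_neqAle auv andbT; apply/eqP => e; apply: nuv.
  have -> : v = u by apply: (dot_inj n0); rewrite ?du ?dv.
  exact: connected_component_refl.
have t0 : t != 0 by apply/eqP => t0; apply: nEu; rewrite -(seg0 u v) -t0.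
have t1 : t != 1 by apply/eqP => t1; apply: nEv; rewrite -(seg1 u v) -t1.
have {}t01 : 0 < t < 1 by rewrite !lt_neqAle eq_sym t0 t1.
by rewrite /a dot_seg -/a; move: t01 => /andP[? ?]; apply/andP; split; nra.
Qed.

(** The set E has points on the first line on both sides of v, whereas the
    component of v joins v to the second line: they are linked. *)
Lemma no_middle E u v w : connected E -> E `<=` S -> closed E \/ closed (S `\` E) ->
  (S `\` E) u -> (S `\` E) v -> (S `\` E) w ->
  dot n u = c1 -> dot n v = c1 -> dot n w = c1 ->
  ~ connected_component (S `\` E) u v -> ~ connected_component (S `\` E) v w ->
  a u <= a v -> a v <= a w -> ~ (connected_component (S `\` E) v `&` level n c2 !=set0).
Proof.
move=> cE ES clE Su Sv Sw du dv dw nuv nvw auv avw [v2 [Vv2 dv2]].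
have [e1 [Ee1 de1 /andP[h1 h2]]] := crossing_between Su Sv du dv nuv auv.
have [e2 [Ee2 de2 /andP[h3 h4]]] := crossing_between Sv Sw dv dw nvw avw.
pose V := connected_component (S `\` E) v.
have VS : V `<=` S `\` E by exact: connected_component_sub.
have Vv : V v by exact: connected_component_refl.
suff [z [Ez /VS[_]]] : E `&` V !=set0 by [].
apply: (linking (coords_sym (coords_dot n0)) (e1 := e2) (e2 := e1) (v1 := v) (v2 := v2)) => //.
- exact: component_connected.
- by case: clE => h; [left|right; exact: component_closed].
- by rewrite dotB subr_gt0.
- by rewrite dotB subr_le0 ltW.
- by move=> e /ES/andP[h _]; rewrite dotB subr_ge0 dv.
- by move=> z /VS[/andP[h _] _]; rewrite dotB subr_le0 de2.
- by left=> z /VS[/andP[h _] _]; rewrite dotB subr_le0 de1.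
- by left=> z /ES/andP[_ h]; rewrite dotB subr_le0 dv2.
Qed.

(** Three crossing components meet the first line in three points, one of which
    is between the others. *)
Lemma crossing_components_compl E : connected E -> E `<=` S ->
  closed E \/ closed (S `\` E) -> finite_set (crossing_components n c1 c2 (S `\` E)).
Proof.
move=> cE ES clE; apply: finite_no_three.
have D A : crossing_components n c1 c2 (S `\` E) A -> exists u,
  [/\ (S `\` E) u, dot n u = c1, A = connected_component (S `\` E) u & A `&` level n c2 !=set0].
  move=> [[x Sx ->] [[u [xu du]] h]]; exists u; split=> //.
    exact: connected_component_sub xu.
  exact: same_connected_component.
move=> A B C /D[u [Su du Au Ac]] /D[v [Sv dv Bv Bc]] /D[w [Sw dw Cw Cc]].
have NC x y X Y : X = connected_component (S `\` E) x -> Y = connected_component (S `\` E) y ->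
    X <> Y -> ~ connected_component (S `\` E) x y.
  by move=> -> -> xy /same_connected_component.
apply: contrapT => nABC.
have AB : A <> B by move=> h; apply: nABC; constructor 1.
have BC : B <> C by move=> h; apply: nABC; constructor 2.
have AC : A <> C by move=> h; apply: nABC; constructor 3.
have nAB := NC u v _ _ Au Bv AB; have nBA := NC v u _ _ Bv Au (nesym AB).
have nBC := NC v w _ _ Bv Cw BC; have nCB := NC w v _ _ Cw Bv (nesym BC).
have nAC := NC u w _ _ Au Cw AC; have nCA := NC w u _ _ Cw Au (nesym AC).
rewrite Au in Ac; rewrite Bv in Bc; rewrite Cw in Cc.
case: (leP (a u) (a v)) => [uv|/ltW vu]; case: (leP (a v) (a w)) => [vw|/ltW wv];
  case: (leP (a u) (a w)) => [uw|/ltW wu].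
- exact: (no_middle cE ES clE Su Sv Sw du dv dw).
- exact: (no_middle cE ES clE Su Sv Sw du dv dw).
- exact: (no_middle cE ES clE Su Sw Sv du dw dv).
- exact: (no_middle cE ES clE Sw Su Sv dw du dv).
- exact: (no_middle cE ES clE Sv Su Sw dv du dw).
- exact: (no_middle cE ES clE Sv Sw Su dv dw du).
- exact: (no_middle cE ES clE Sw Sv Su dw dv du).
- exact: (no_middle cE ES clE Sw Sv Su dw dv du).
Qed.

Lemma is_componentP X A x : is_component X A -> A x -> A = connected_component X x.
Proof. by move=> [y Xy ->]; exact: same_connected_component. Qed.

(** Each crossing component A of X is sent, for every crossing component E of Y,
    to the component of S `\` E containing A, which has at most two possible
    values.  These data determine A: two components of X are separated by some
    component E of Y, and E is crossing because otherwise they would be joined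
    by a boundary line outside E. *)
Lemma crossing_transfer X Y : X `<=` S -> Y `<=` S -> X `&` Y = set0 ->
  (forall E, is_component Y E -> closed E \/ closed (S `\` E)) ->
  (forall x y, X x -> X y -> ~ connected_component X x y ->
     exists2 E, is_component Y E & ~ connected_component (S `\` E) x y) ->
  finite_set (crossing_components n c1 c2 Y) ->
  finite_set (crossing_components n c1 c2 X).
Proof.
move=> XS YS XY clY sep fY.
pose f E A := \bigcup_(x in A) connected_component (S `\` E) x.
have XE E : is_component Y E -> X `<=` S `\` E.
  move=> [y Yy ->] x Xx; split; first exact: XS.
  by move=> /connected_component_sub Yx; rewrite -[False]/(set0 x) -XY.
have AX A : is_component X A -> A `<=` X.
  by move=> [y Xy ->]; exact: connected_component_sub.
have coA Z A : is_component Z A -> connected A.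
  by move=> [y _ ->]; exact: component_connected.
have fE E A x : is_component Y E -> is_component X A -> A x ->
    f E A = connected_component (S `\` E) x.
  move=> cE cA Ax; apply/seteqP; split=> z; last by move=> xz; exists x.
  move=> [y Ay yz]; apply: connected_component_trans yz.
  apply: (connected_component_max (B := A)) => //; last exact: coA cA.
  by move=> w /(AX _ cA) /(XE _ cE).
apply: (finite_separated (f := f) fY).
- move=> E [cE _].
  apply: (@sub_finite_set _ _ (crossing_components n c1 c2 (S `\` E))).
    move=> _ [A [cA [[u [Au du]] [v [Av dv]]]] <-].
    have Af z : A z -> f E A z.
      move=> Az; exists z => //; apply: connected_component_refl.
      by apply: (XE _ cE); exact: (AX _ cA).
    split.
      by exists u; [apply: (XE _ cE); exact: (AX _ cA)|exact: fE].
    by split; [exists u; split=> //; exact: Af|exists v; split=> //; exact: Af].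
  apply: crossing_components_compl; [exact: coA cE| |exact: clY].
  by move: cE => [y Yy ->] z /connected_component_sub/YS.
move=> A B [cA [[a1 [Aa1 da1]] [a2 [Aa2 da2]]]] [cB [[b1 [Bb1 db1]] [b2 [Bb2 db2]]]] hf.
apply: contrapT => AB.
have [|E cE nE] := sep a1 b1 (AX _ cA _ Aa1) (AX _ cB _ Bb1).
  by move=> /same_connected_component; rewrite -(is_componentP cA Aa1) -(is_componentP cB Bb1).
have join c (p q : plane R) : c1 <= c <= c2 -> A p -> B q -> level n c p -> level n c q ->
    E `&` level n c !=set0.
  move=> hc Ap Bq pc qc; apply/set0P/negP => /eqP El; apply: nE.
  have hA : A `<=` S `\` E by apply: subset_trans (XE _ cE); exact: AX.
  have hB : B `<=` S `\` E by apply: subset_trans (XE _ cE); exact: AX.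
  have lS : level n c `<=` S `\` E.
    move=> z lz; split; first exact: (level_strip hc).
    by move=> Ez; rewrite -[False]/(set0 z) -El.
  have c1' : connected_component (S `\` E) a1 p.
    by apply: (connected_component_max (B := A)) => //; exact: coA cA.
  have c2' : connected_component (S `\` E) p q.
    by apply: (connected_component_max (B := level n c)) => //; apply: convex_connected;
      exact: convex_level.
  have c3' : connected_component (S `\` E) q b1.
    by apply: (connected_component_max (B := B)) => //; exact: coA cB.
  exact: connected_component_trans c1' (connected_component_trans c2' c3').
apply: nE; rewrite -(fE E A a1)// hf; last first.
  split=> //; split; [apply: (join c1 a1 b1)|apply: (join c2 a2 b2)] => //.
  - by rewrite lexx ltW.
  - by rewrite lexx ltW.
by exists b1 => //; apply: connected_component_refl; apply: (XE _ cE); exact: (AX _ cB).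
Qed.

Lemma crossing_duality K : compact K ->
  finite_set (crossing_components n c1 c2 (S `\` K)) <->
  finite_set (crossing_components n c1 c2 (K `&` S)).
Proof.
move=> cK; set F := K `&` S.
have clS : closed S by exact: closed_strip.
have coS : convex S by exact: convex_strip.
have cF : compact F by apply: compact_closedI.
have clF : closed F by exact: plane_compact_closed.
have FS : F `<=` S by move=> z [].
have -> : S `\` K = S `\` F.
  by rewrite /F setDIr setDv setU0.
split; apply: crossing_transfer => //.
- by rewrite setDIK.
- by move=> E [y _ ->]; right; exact: component_compl_closed.
- move=> x y Fx Fy nxy; have [p Sp np] := separation_gap clS coS cF FS Fx Fy nxy.
  by exists (connected_component (S `\` F) p) => //; exists p.
- by rewrite setIC setDIK.
- by move=> E [y _ ->]; left; exact: component_closed.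
- move=> x y Sx Sy nxy; apply: contrapT => nE; apply: nxy.
  apply: separation_component => // q Fq; apply: contrapT => nq; apply: nE.
  by exists (connected_component F q) => //; exists q.
Qed.

End OneStrip.
End Strips.

(** * Strips bounded by two parallel lines *)

Section LinesAndStrips.
Context {R : realType}.
Implicit Types (x y z n u v w e p : plane R) (A B C E F G K M O P Q S U V X Y Z : set
  (plane R)).
Implicit Types c s t : R.

Lemma dotD n x y : dot n (x + y) = dot n x + dot n y.
Proof. by case: n x y => a b [c d] [e f]; rewrite /dot /=; ring. Qed.

Lemma dotZ n x t : dot n (t%:C *: x) = t * dot n x.
Proof. by case: n x => a b [c d]; rewrite /dot /=; ring. Qed.

Lemma dot_perp n : dot (n * 'i) n = 0.
Proof. by case: n => a b; rewrite /dot /=; ring. Qed.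

(** The point is reached from z by moving along n. *)
Lemma dot_shift n z d : n != 0 ->
  exists y, dot n y = d /\ dot (n * 'i) y = dot (n * 'i) z.
Proof.
move=> n0; exists (z + ((d - dot n z) / dot n n)%:C *: n).
rewrite !dotD !dotZ dot_perp mulr0 addr0; split=> //.
by rewrite divfK ?gt_eqF ?dot_self_gt0// addrC subrK.
Qed.

Lemma line_level p v : v != 0 -> line p v = level (v * 'i) (dot (v * 'i) p).
Proof.
move=> v0; apply/seteqP; split=> z.
  by move=> [t _ <-]; rewrite /level /= dotD dotZ dot_perp mulr0 addr0.
rewrite /level /= => zp; exists (dot v (z - p) / dot v v) => //.
apply: (dot_inj v0); last by rewrite zp dotD dotZ dot_perp mulr0 addr0.
by rewrite dotD dotZ divfK ?gt_eqF ?dot_self_gt0// dotB addrC subrK.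
Qed.

(** The intermediate value theorem on a connected set. *)
Lemma connected_level n c C x y : connected C -> C x -> C y ->
  dot n x < c -> c < dot n y -> C `&` level n c !=set0.
Proof.
move=> cC Cx Cy xc cy; apply/set0P/negP => /eqP Cl.
suff : dot n y < c by rewrite ltNge ltW.
apply: (connected_ind (Pr := fun z => dot n z < c) cC _ Cx Cy) => // z Cz.
have [zc|zc] := ltP (dot n z) c.
  have := near_in (open_sublevel (c := c) (@dot_continuous R n)) zc.
  by apply: filterS => w /= wc.
have {}zc : c < dot n z.
  rewrite lt_neqAle zc andbT; apply/eqP => e; rewrite -[False]/(set0 z) -Cl; split=> //.
have := near_in (open_superlevel (c := c) (@dot_continuous R n)) zc.
by apply: filterS => w /= wc _; rewrite ltNge (ltW wc).
Qed.

Section OpenStrip.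
Context (n : plane R) (n0 : n != 0) (c1 c2 : R) (c12 : c1 < c2).

Definition ostrip : set (plane R) := [set z | c1 < dot n z < c2].

Lemma open_ostrip : open ostrip.
Proof.
rewrite (_ : ostrip = [set z | c1 < dot n z] `&` [set z | dot n z < c2]).
  by apply: openI; [apply: open_superlevel|apply: open_sublevel]; exact: dot_continuous.
by apply/seteqP; split=> z; [move=> /andP[]|move=> [? ?]; exact/andP].
Qed.

Lemma closure_ostrip : closure ostrip = strip n c1 c2.
Proof.
apply/seteqP; split=> z.
  rewrite -[strip n c1 c2 z]/(strip n c1 c2 z) => cz.
  have := @closed_strip R n c1 c2; rewrite closure_id => ->.
  by apply: closure_subset cz => w /andP[? ?]; apply/andP; split; exact: ltW.
move=> /andP[]; rewrite le_eqVlt => /orP[/eqP z1 _|z1].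
  move=> B; have [_ _ h] := coords_dot n0; move=> /h[e e0 eB].
  have [y [y1 y2]] := dot_shift z (c1 + Num.min e (c2 - c1) / 2) n0.
  have m0 : 0 < Num.min e (c2 - c1) by rewrite lt_min e0 subr_gt0.
  have m1 : Num.min e (c2 - c1) <= e by rewrite ge_min lexx.
  have m2 : Num.min e (c2 - c1) <= c2 - c1 by rewrite ge_min lexx orbT.
  exists y; split; first by rewrite /ostrip /= y1; apply/andP; split; lra.
  apply: eB; last by rewrite y2 subrr normr0.
  by rewrite y1 -z1 ltr_norml; apply/andP; split; lra.
rewrite le_eqVlt => /orP[/eqP z2|z2]; last first.
  by apply: subset_closure; apply/andP.
move=> B; have [_ _ h] := coords_dot n0; move=> /h[e e0 eB].
have [y [y1 y2]] := dot_shift z (c2 - Num.min e (c2 - c1) / 2) n0.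
have m0 : 0 < Num.min e (c2 - c1) by rewrite lt_min e0 subr_gt0.
have m1 : Num.min e (c2 - c1) <= e by rewrite ge_min lexx.
have m2 : Num.min e (c2 - c1) <= c2 - c1 by rewrite ge_min lexx orbT.
exists y; split; first by rewrite /ostrip /= y1; apply/andP; split; lra.
apply: eB; last by rewrite y2 subrr normr0.
by rewrite y1 z2 ltr_norml; apply/andP; split; lra.
Qed.

Let L := level n c1 `|` level n c2.

Lemma convex_ostrip : convex ostrip.
Proof.
move=> x y t /andP[? ?] /andP[? ?] t01; rewrite /ostrip /= dot_seg.
by apply/andP; split; [exact: conv_gt|exact: conv_lt].
Qed.

Lemma ostrip_component x : ostrip x -> connected_component (~` L) x = ostrip.
Proof.
move=> Ox.
have OL : ostrip `<=` ~` L.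
  by move=> z /andP[z1 z2] []; rewrite /level /=; lra.
apply/seteqP; split=> z; last first.
  move=> Oz; apply: (connected_component_max (B := ostrip)) => //.
  by apply: convex_connected; exact: convex_ostrip.
move=> xz; have Lz := connected_component_sub xz.
have xx : connected_component (~` L) x x by apply: connected_component_refl; exact: OL.
have cC := @component_connected _ (~` L) x.
have noL c : level n c `<=` L -> ~ (connected_component (~` L) x `&` level n c !=set0).
  by move=> lL [w [/connected_component_sub nw /lL]].
have [x1 x2] := andP Ox; apply/andP; split.
  rewrite lt_neqAle leNgt; apply/andP; split; first by apply/eqP => e; apply: Lz; left.
  apply/negP => zc; apply: (noL c1); first by move=> w; left.
  exact: connected_level cC xz xx zc x1.
rewrite lt_neqAle leNgt; apply/andP; split; first by apply/eqP => e; apply: Lz; right.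
apply/negP => zc; apply: (noL c2); first by move=> w; right.
exact: connected_level cC xx xz x2 zc.
Qed.

Lemma is_strip_ostrip : is_strip (level n c1) (level n c2) ostrip.
Proof.
have [x [dx _]] := dot_shift 0 ((c1 + c2) / 2) n0.
have Ox : ostrip x by rewrite /ostrip /= dx; rewrite !midf_lt.
split.
  exists x; last by rewrite ostrip_component.
  by case/andP: Ox => z1 z2 []; rewrite /level /=; lra.
rewrite /boundary closure_ostrip; have /interior_id -> := open_ostrip.
apply/seteqP; split=> z.
  move=> [/andP[z1 z2] /negP]; rewrite negb_and -!leNgt => /orP[h|h]; [left|right];
    by apply/eqP; rewrite eq_le h ?z1 ?z2.
by case; rewrite /level /strip /ostrip /= => ->; rewrite lexx ?ltW// ltxx ?andbF; split.
Qed.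

(** Of the three components of the complement of the two lines, each half-plane
    has closure missing one of the lines. *)
Lemma is_strip_closure U : is_strip (level n c1) (level n c2) U ->
  closure U = strip n c1 c2.
Proof.
move=> [[x Lx ->] bd].
have cC := @component_connected _ (~` L) x.
have xx : connected_component (~` L) x x by exact: connected_component_refl.
have noL c : level n c `<=` L -> ~ (connected_component (~` L) x `&` level n c !=set0).
  by move=> lL [w [/connected_component_sub nw /lL]].
suff Ox : ostrip x by rewrite ostrip_component// closure_ostrip.
have bdU c : level n c `<=` L -> level n c `<=` closure (connected_component (~` L) x).
  move=> lL z /lL Lz; have : boundary (connected_component (~` L) x) z by rewrite bd.
  by case.
apply/andP; split.
  rewrite lt_neqAle leNgt; apply/andP; split; first by apply/eqP => e; apply: Lx; left.
  apply/negP => xc.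
  have Ule : connected_component (~` L) x `<=` [set z | dot n z <= c1].
    move=> z xz /=; rewrite leNgt; apply/negP => zc; apply: (noL c1); first by move=> w; left.
    exact: connected_level cC xx xz xc zc.
  have [y [dy _]] := dot_shift 0 c2 n0.
  have := bdU c2 (fun w h => or_intror h) y dy; move=> /(closure_subset Ule).
  have /closure_id <- := closed_sublevel (c := c1) (@dot_continuous R n).
  by rewrite /= dy leNgt c12.
rewrite lt_neqAle leNgt; apply/andP; split; first by apply/eqP => e; apply: Lx; right.
apply/negP => xc.
have Ule : connected_component (~` L) x `<=` [set z | c2 <= dot n z].
  move=> z xz /=; rewrite leNgt; apply/negP => zc; apply: (noL c2); first by move=> w; right.
  exact: connected_level cC xz xx zc xc.
have [y [dy _]] := dot_shift 0 c1 n0.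
have := bdU c1 (fun w h => or_introl h) y dy; move=> /(closure_subset Ule).
have /closure_id <- := closed_superlevel (c := c2) (@dot_continuous R n).
by rewrite /= dy leNgt c12.
Qed.

End OpenStrip.

Definition finitely_crossed K := forall n c1 c2, n != 0 -> c1 < c2 ->
  finite_set (crossing_components n c1 c2 (K `&` strip n c1 c2)).

Lemma schonflies_crossed K : compact K -> schonflies K <-> finitely_crossed K.
Proof.
move=> cK; split=> [sK n c1 c2 n0 c12|fK L1 L2 U [p1 [p2 [v [v0 -> ->]]]]].
  apply/(crossing_duality n0 c12 cK).
  have [p1 [d1 _]] := dot_shift 0 c1 n0; have [p2 [d2 _]] := dot_shift 0 c2 n0.
  pose v : plane R := n * (- 'i).
  have vi : v * 'i = n by rewrite /v mulrN mulNr -mulrA mulCii mulrN1 opprK.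
  have v0 : v != 0 by apply/eqP => v0; move: n0; rewrite -vi v0 mul0r eqxx.
  have E1 : line p1 v = level n c1 by rewrite line_level// vi d1.
  have E2 : line p2 v = level n c2 by rewrite line_level// vi d2.
  have := sK (level n c1) (level n c2) (ostrip n c1 c2).
  rewrite closure_ostrip//; set X := finite_set _; set Y := finite_set _.
  have -> : X = Y.
    rewrite /X /Y; congr finite_set; apply/seteqP; split=> A; first by case.
    by case=> ? [].
  apply.
  - by exists p1, p2, v; rewrite E1 E2.
  - move=> e; have : level n c1 p1 by [].
    by rewrite e /level /= d1; lra.
  - exact: is_strip_ostrip.
rewrite !line_level//; set n := v * 'i.
have n0 : n != 0.
  rewrite /n mulf_neq0//; exact: neq0Ci.
move: (dot n p1) (dot n p2) => c1 c2.
wlog c12 : c1 c2 / c1 < c2 => [wl|] ne.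
  have [c12|c21|e] := ltgtP c1 c2; first exact: wl.
    move=> sU; have := wl c2 c1 c21 (nesym ne).
    rewrite /is_strip setUC => /(_ sU); apply: sub_finite_set => A [? ? ?]; by split.
  by case: ne; rewrite e.
move=> /(is_strip_closure n0 c12) ->.
have /(crossing_duality n0 c12 cK) := fK n c1 c2 n0 c12.
by apply: sub_finite_set => A [? ? ?].
Qed.

End LinesAndStrips.

(** * Small components *)

Section Components.
Context {R : realType}.
Implicit Types (x y z n u v w e p : plane R) (A B C D E F G K M O P Q S T U V W X Y Z : set
  (plane R)).
Implicit Types c s t r : R.

Lemma is_component_connected X A : is_component X A -> connected A.
Proof. by move=> [x _ ->]; exact: component_connected. Qed.

Lemma is_component_sub X A : is_component X A -> A `<=` X.
Proof. by move=> [x _ ->]; exact: connected_component_sub. Qed.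

Lemma is_component_max X A B x : is_component X A -> connected B -> B `<=` X ->
  A x -> B x -> B `<=` A.
Proof.
move=> cA cB BX Ax Bx; rewrite (is_componentP cA Ax).
exact: connected_component_max.
Qed.

(** Such an A is the union of the components of X through the points of B, for
    any B inside it, hence a function of B. *)
Lemma finite_components X Y (G : set (set (plane R))) : finite_set [set B | is_component Y
  B /\ G B] ->
  finite_set [set A | is_component X A /\ exists B, [/\ is_component Y B, G B & B `<=` A]].
Proof.
move=> fG.
apply: sub_finite_set (finite_image (fun B => \bigcup_(z in B) connected_component X z) fG).
move=> A [cA [B [cB GB BA]]]; exists B => //; apply/seteqP; split=> x.
  by move=> [z Bz]; rewrite -(is_componentP cA (BA _ Bz)).
move=> Ax; have [z Yz BE] := cB; have Bz : B z by rewrite BE; exact: connected_component_refl.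
by exists z => //; rewrite -(is_componentP cA (BA _ Bz)).
Qed.

Lemma finite_components_crossing K n c1 c2 : compact K -> finitely_crossed K ->
  n != 0 -> c1 < c2 ->
  finite_set [set A | is_component K A /\
    exists x y, [/\ A x, A y, dot n x <= c1 & c2 <= dot n y]].
Proof.
move=> cK fK n0 c12.
apply: sub_finite_set (@finite_components K _ _ (fK n c1 c2 n0 c12)).
move=> A [cA [x [y [Ax Ay xc yc]]]]; split=> //.
have cpA : compact A by case: cA => p _ ->; exact: component_compact.
have [z [Az zc [w zw wc]]] := crossing (@dot_continuous R n) cpA (is_component_connected
  cA) c12 Ax xc Ay yc.
have AK := is_component_sub cA.
have Sz : (K `&` strip n c1 c2) z by split; [exact: AK|rewrite /strip /= zc lexx ltW].
have cB : is_component (K `&` strip n c1 c2) (connected_component (K `&` strip n c1 c2) z)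
  by exists z.
exists (connected_component (K `&` strip n c1 c2) z); split=> //; last first.
  apply: (is_component_max cA) Az _ => //.
  - exact: component_connected.
  - by move=> ? /connected_component_sub[].
  - exact: connected_component_refl.
split; [exists z|exists w]; split=> //; first exact: connected_component_refl.
apply: (is_component_max cB) zw => //.
- exact: component_connected.
- by move=> ? /connected_component_sub[/AK].
- exact: connected_component_refl.
- apply: connected_component_refl; split=> //; by case: Sz.
Qed.

Lemma peano_crossed K : compact K ->
  (forall A, is_component K A -> peano_continuum A) ->
  (forall c : R, 0 < c -> finite_set [set A | is_component K A /\ ~ (diameter A < c%:E)%E]) ->
  finitely_crossed K.
Proof.
move=> cK peano null n c1 c2 n0 c12; set S := strip n c1 c2.
pose m := (c1 + c2) / 2.
(* A lower bound for the length of vectors joining the two lines, by the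
   Cauchy-Schwarz inequality. *)
have [c c0 hc] : exists2 c : R, 0 < c & forall z, c2 - c1 <= dot n z -> c <= Normc.normc z.
  pose q := complex.Re n ^+ 2 + complex.Im n ^+ 2.
  have q0 : 0 < q by have := dot_self_gt0 n0; rewrite /dot -!expr2.
  exists ((c2 - c1) / Num.sqrt q); first by rewrite divr_gt0 ?subr_gt0// sqrtr_gt0.
  move=> z hz; rewrite ler_pdivrMr ?sqrtr_gt0//.
  have -> : Normc.normc z = Num.sqrt (complex.Re z ^+ 2 + complex.Im z ^+ 2) by case: z {hz}.
  rewrite -sqrtrM ?addr_ge0 ?sqr_ge0// mulrC -dot_sqr.
  apply: le_trans hz _; apply: le_trans (ler_norm _) _; rewrite -sqrtr_sqr.
  by apply: ler_wsqrtr; rewrite lerDl sqr_ge0.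
pose bad := [set A | is_component K A /\ ~ (diameter A < c%:E)%E].
apply: (@sub_finite_set _ _ (\bigcup_(A in bad)
  [set Q | crossing_components n c1 c2 (K `&` S) Q /\ Q `&` (A `&` level n m) !=set0])).
  move=> Q hQ; have [cQ [[u [Qu du]] [v [Qv dv]]]] := hQ.
  have Ku : K u by case: (is_component_sub cQ Qu).
  pose A := connected_component K u.
  have cA : is_component K A by exists u.
  have Au : A u by exact: connected_component_refl.
  have QA : Q `<=` A.
    apply: (is_component_max cA) Au Qu; first exact: is_component_connected cQ.
    by move=> z /(is_component_sub cQ)[].
  exists A.
    split=> //; apply/negP; rewrite -leNgt.
    apply: (@le_trans _ _ (Normc.normc (v - u))%:E).
      by rewrite lee_fin; apply: hc; rewrite dotB du dv.
    apply: ereal_sup_ubound; exists (v, u) => //; split; exact: QA.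
  split=> //.
  have [||z [Qz dz]] := connected_level (n := n) (c := m) (is_component_connected cQ) Qu Qv.
  - by rewrite du /m midf_lt.
  - by rewrite dv /m midf_lt.
  by exists z; split=> //; split=> //; exact: QA.
apply: bigcup_finite; first exact: null.
move=> A [cA _]; have [cpA _ lcA] := peano A cA.
apply: (compact_ind (Pr := fun Z => finite_set [set Q | crossing_components n c1 c2 (K `&`
  S) Q /\ Q `&` Z !=set0])).
- apply: compact_closedI => //.
  rewrite (_ : level n m = [set z | m <= dot n z] `&` [set z | dot n z <= m]).
    by apply: closedI; [apply: closed_superlevel|apply: closed_sublevel]; exact: dot_continuous.
  apply/seteqP; split=> z; first by rewrite /level /= => ->.
  by move=> [/= h1 h2]; apply/eqP; rewrite eq_le h1 h2.
- rewrite (_ : [set _ | _] = set0)//; apply/seteqP; split=> // Q [_ [z []]] //.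
- by move=> X Y XY; apply: sub_finite_set => Q [hQ [z [Qz /XY Yz]]]; split=> //; exists z.
- move=> X Y fX fY; apply: (@sub_finite_set _ _ ([set Q | crossing_components n c1 c2 (K
  `&` S) Q /\ Q `&` X !=set0] `|` [set Q | crossing_components n c1 c2 (K `&` S) Q /\ Q `&`
    Y !=set0])).
    by move=> Q [hQ [z [Qz [Xz|Yz]]]]; [left|right]; split=> //; exists z.
  by rewrite finite_setU.
move=> x [Ax dx].
have Ox : ostrip n c1 c2 x by rewrite /ostrip /= dx /m !midf_lt.
have [W [oW Wx cW WO]] := lcA x (ostrip n c1 c2) Ax (@open_ostrip R n c1 c2) Ox.
exists W; first exact: near_in.
apply: (@sub_finite_set _ _ [set connected_component (K `&` S) x]); last exact: finite_set1.
move=> Q [[cQ _] [z [Qz [[Az _] Wz]]]] /=.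
have WS : A `&` W `<=` K `&` S.
  move=> w AWw; split; first by apply: (is_component_sub cA); case: AWw.
  by have /andP[? ?] := WO _ AWw; apply/andP; split; exact: ltW.
apply: (is_componentP cQ); apply: (is_component_max cQ cW WS Qz) => //.
Qed.

(** A component of diameter at least c has width more than c / 4 in one
    coordinate direction, and so crosses a strip between two consecutive lines of
    a grid of mesh c / 8. *)
Lemma crossed_null K (c : R) : compact K -> finitely_crossed K -> 0 < c ->
  finite_set [set A | is_component K A /\ ~ (diameter A < c%:E)%E].
Proof.
move=> cK fK c0; have [m m0 Km] := compact_sub_sq cK.
pose d := c / 8; have d0 : 0 < d by rewrite divr_gt0.
pose g (j : nat) : R := - m + j%:R * d.
pose N := (Num.truncn (2 * m / d)).+3.
pose big n j := [set A | is_component K A /\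
    exists x y, [/\ A x, A y, dot n x <= g j & g j.+1 <= dot n y]].
have fbig n j : n != 0 -> finite_set (big n j).
  by move=> n0; apply: finite_components_crossing => //; rewrite /g -natr1; lra.
have i0 : ('i : plane R) != 0 by exact: neq0Ci.
have o0 : (1 : plane R) != 0 by exact: oner_neq0.
apply: (@sub_finite_set _ _ ((\bigcup_(j in `I_N) big 1 j) `|` (\bigcup_(j in `I_N) big 'i
  j))); last first.
  by rewrite finite_setU; split; apply: bigcup_finite => // j _; exact: fbig.
move=> A [cA dA].
have AK := is_component_sub cA.
have key n x y : A x -> A y -> (forall z, A z -> `|dot n z| < m) ->
    c / 4 < dot n y - dot n x -> (\bigcup_(j in `I_N) big n j) A.
  move=> Ax Ay nm hxy.
  (* The first line of the grid above the level of x. *)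
  pose j := (Num.truncn ((dot n x + m) / d)).+1.
  have := nm x Ax; have := nm y Ay; rewrite !ltr_norml => /andP[y1 y2] /andP[x1 x2].
  have j1 : (dot n x + m) / d < j%:R by rewrite /j; exact: truncnS_gt.
  have j2 : j%:R - 1 <= (dot n x + m) / d.
    by rewrite /j -natr1 addrK truncn_le divr_ge0 ?(ltW d0)//; lra.
  rewrite ltr_pdivrMr// in j1; rewrite ler_pdivlMr// in j2.
  exists j; last first.
    split=> //; exists x, y; split=> //; rewrite /g; first lra.
    rewrite -[j.+1%:R]natr1.
    have := hxy; rewrite (_ : c / 4 = 2 * d); last by rewrite /d; lra.
    nra.
  rewrite /= /N -(ltr_nat R).
  have := truncnS_gt (2 * m / d); rewrite ltr_pdivrMr// => h.
  rewrite -(ltr_pM2r d0); move: (Num.truncn _) h => k; rewrite -[k.+1%:R]natr1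
    -[k.+3%:R]natr1 -[k.+2%:R]natr1 -[k.+1%:R]natr1; nra.
have abs n x y : A x -> A y -> (forall z, A z -> `|dot n z| < m) ->
    c / 4 < `|dot n y - dot n x| -> (\bigcup_(j in `I_N) big n j) A.
  move=> Ax Ay nm; rewrite ltr_normr => /orP[h|h]; first exact: (key n x y).
  by apply: (key n y x) => //; lra.
have dRe z : dot 1 z = complex.Re z by rewrite /dot /= mul1r mul0r addr0.
have dIm z : dot 'i z = complex.Im z by rewrite /dot /= mul1r mul0r add0r.
have b1 z : A z -> `|dot 1 z| < m.
  by move=> /AK/Km[+ _]; rewrite dRe subr0.
have b2 z : A z -> `|dot 'i z| < m.
  by move=> /AK/Km[_ +]; rewrite dIm subr0.
apply: contrapT => nA; apply: dA.
apply: (@le_lt_trans _ _ (c / 2)%:E); last by rewrite lte_fin; lra.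
apply: ge_ereal_sup => _ [[x y] [/= Ax Ay] <-]; rewrite lee_fin.
have h1 : `|complex.Re x - complex.Re y| <= c / 4.
  by rewrite -!dRe leNgt; apply/negP => h; apply: nA; left; exact: (abs 1 y x).
have h2 : `|complex.Im x - complex.Im y| <= c / 4.
  by rewrite -!dIm leNgt; apply/negP => h; apply: nA; right; exact: (abs 'i y x).
have -> : Normc.normc (x - y) = Num.sqrt ((complex.Re x - complex.Re y) ^+ 2 + (complex.Im
  x - complex.Im y) ^+ 2).
  by case: x y {Ax Ay h1 h2} => ? ? [? ?].
rewrite -(ger0_norm (_ : 0 <= c / 2)); last by rewrite divr_ge0// ltW.
rewrite -sqrtr_sqr; apply: ler_wsqrtr.
have sq (r : R) : `|r| <= c / 4 -> r ^+ 2 <= (c / 4) ^+ 2.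
  by move=> h; rewrite -real_normK ?num_real// ler_pXn2r// nnegrE// divr_ge0// ltW.
have := sq _ h1; have := sq _ h2; rewrite !exprMn; have := sqr_ge0 c; rewrite /=.
lra.
Qed.

End Components.

(** * Local connectedness of the components *)

Section LocallyConnected.
Context {R : realType}.
Implicit Types (x y z n u v w e p : plane R) (A B C D E F G K M O P Q S T U V W X Y Z : set
  (plane R)).
Implicit Types c s t r l : R.

(** Of the two points on the side a = l, take the lower one q, in B say: A
    joins the upper point p to the bottom, and B joins q to the top, so they are
    linked. *)
Lemma side_disjoint (a b : plane R -> R) l s t A B : coords a b ->
  connected A -> connected B -> closed A -> closed B ->
  (forall z, A z -> l <= a z /\ s <= b z <= t) ->
  (forall z, B z -> l <= a z /\ s <= b z <= t) ->
  (exists2 z, A z & b z = s) -> (exists2 z, A z & b z = t) ->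
  (exists2 z, B z & b z = s) -> (exists2 z, B z & b z = t) ->
  (exists2 z, A z & a z = l) -> (exists2 z, B z & a z = l) -> A `&` B !=set0.
Proof.
move=> ab cA cB clA clB hA hB As At Bs Bt [p Ap pl] [q Bq ql].
have [aD bD _] := ab.
wlog pq : A B p q cA cB clA clB hA hB As At Bs Bt Ap pl Bq ql / b q < b p => [wl|].
  have [pq|pq|pq] := ltgtP (b p) (b q).
  - by rewrite setIC; apply: (wl B A q p).
  - exact: (wl A B p q).
  - have e : p = q by apply: (coords_inj ab) => //; rewrite pl ql.
    by exists q; split=> //; rewrite -e.
have [u Au us] := As; have [v Bv vt] := Bt.
apply: (linking (coords_sym ab) (e1 := p) (e2 := u) (v1 := q) (v2 := v)) => //.
- by left.
- by rewrite bD subr_gt0.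
- by rewrite bD subr_le0 us; case: (hB q Bq) => _ /andP[].
- by move=> e /hA[h _]; rewrite aD subr_ge0 ql.
- by move=> e /hB[h _]; rewrite aD subr_le0 pl.
- by right=> e /hB[_ /andP[h _]]; rewrite bD subr_le0 us.
- by right=> e /hA[_ /andP[_ h]]; rewrite bD subr_le0 vt.
Qed.

(** A crossing component of the rectangle that touches neither lateral side is a
    component of the whole strip, by boundary bumping; at most one touches each
    lateral side. *)
Lemma finite_rect_crossing K A n c1 c2 l r : compact K -> finitely_crossed K ->
  is_component K A -> n != 0 -> c1 < c2 ->
  finite_set (crossing_components n c1 c2
    (A `&` (strip n c1 c2 `&` strip (n * 'i) l r))).
Proof.
move=> cK fK cA n0 c12; set a := dot (n * 'i); set X := A `&` _.
have cpA : compact A by case: cA => p _ ->; exact: component_compact.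
have clX : closed X.
  apply: closedI; first exact: plane_compact_closed.
  by apply: closedI; exact: closed_strip.
have disj D D' : is_component X D -> is_component X D' -> D `&` D' !=set0 -> D = D'.
  by move=> cD cD' [z [Dz Dz']]; rewrite (is_componentP cD Dz) (is_componentP cD' Dz').
have clD D : is_component X D -> closed D by move=> [z _ ->]; exact: component_closed.
have XE D z : is_component X D -> D z -> l <= a z <= r /\ c1 <= dot n z <= c2.
  by move=> cD /(is_component_sub cD)[_ []].
have ab := coords_sym (coords_dot n0).
have side (sg : bool) : finite_set [set D | crossing_components n c1 c2 X D /\
    exists2 z, D z & a z = if sg then l else r].
  apply: finite_no_three => D D' D'' [[cD [[u [Du us]] [v [Dv vt]]]] pD]
    [[cD' [[u' [Du' us']] [v' [Dv' vt']]]] pD'] _.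
  constructor 1; apply: disj => //.
  case: sg pD pD' => -[p Dp pl] [p' Dp' pl'].
    apply: (side_disjoint (l := l) (s := c1) (t := c2) ab); try by [exact:
      is_component_connected cD|exact: is_component_connected cD'|exact: clD].
    - by move=> z /(XE _ _ cD)[/andP[]].
    - by move=> z /(XE _ _ cD')[/andP[]].
    - by exists u.
    - by exists v.
    - by exists u'.
    - by exists v'.
    - by exists p.
    - by exists p'.
  apply: (side_disjoint (l := - r) (s := c1) (t := c2) (coordsN ab)); try by [exact:
    is_component_connected cD|exact: is_component_connected cD'|exact: clD].
  - by move=> z Dz; have [/andP[_ h] h'] := XE _ _ cD Dz; rewrite lerN2.
  - by move=> z Dz; have [/andP[_ h] h'] := XE _ _ cD' Dz; rewrite lerN2.
  - by exists u.
  - by exists v.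
  - by exists u'.
  - by exists v'.
  - by exists p => //; congr (- _).
  - by exists p' => //; congr (- _).
apply: (@sub_finite_set _ _ (crossing_components n c1 c2 (K `&` strip n c1 c2) `|`
  ([set D | crossing_components n c1 c2 X D /\ exists2 z, D z & a z = l] `|`
   [set D | crossing_components n c1 c2 X D /\ exists2 z, D z & a z = r]))); last first.
  by rewrite !finite_setU; split; [exact: fK|split; [exact: (side true)|exact: (side false)]].
move=> D hD; have [cD crD] := hD.
have [lD|nl] := pselect (exists2 z, D z & a z = l); first by right; left.
have [rD|nr] := pselect (exists2 z, D z & a z = r); first by right; right.
left; split=> //.
have [z Xz DE] := cD; have Dz : D z by rewrite DE; exact: connected_component_refl.
have [Az [Sz az]] := Xz; have AK := is_component_sub cA.
have Yz : (K `&` strip n c1 c2) z by split=> //; exact: AK.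
exists z => //; apply/seteqP; split.
  apply: connected_component_max => //; last exact: is_component_connected cD.
  by move=> w /(is_component_sub cD)[/AK ? []].
pose E := connected_component (K `&` strip n c1 c2) z.
have cE : connected E by exact: component_connected.
have EY : E `<=` K `&` strip n c1 c2 by exact: connected_component_sub.
have Ez : E z by exact: connected_component_refl.
have EA : E `<=` A by apply: (is_component_max cA cE) Az Ez => w /EY[].
pose O := ostrip (n * 'i) l r.
(* A larger component E of the strip would leave the rectangle through a
   lateral side, already inside D. *)
have EM : E `<=` strip (n * 'i) l r.
  apply: (boundary_bumping (O := O) (z := z)) => //.
  - apply: component_compact; apply: compact_closedI => //; exact: closed_strip.
  - exact: closed_strip.
  - exact: open_ostrip.
  - by move=> w /andP[? ?]; apply/andP; split; exact: ltW.
  - have sub : connected_component (E `&` strip (n * 'i) l r) z `<=` D.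
      apply: (is_component_max cD) Dz _.
      + exact: component_connected.
      + by move=> w /connected_component_sub[Ew Mw]; split; [exact: EA|split=> //; case:
        (EY _ Ew)].
      + exact: connected_component_refl.
    move=> w /sub Dw; have [/andP[h1 h2] _] := XE _ _ cD Dw.
    apply/andP; split; rewrite lt_neqAle -/a ?h1 ?h2 andbT; apply/eqP => e.
      by apply: nl; exists w.
    by apply: nr; exists w.
rewrite -/E; apply: (is_component_max cD cE _ Dz Ez) => w Ew.
by split; [exact: EA|split; [case: (EY _ Ew)|exact: EM]].
Qed.

Definition cbox y r : set (plane R) :=
  rect (complex.Re y - r) (complex.Re y + r) (complex.Im y - r) (complex.Im y + r).

(** The outward normals of the four sides of the box. *)
Definition dirs : seq (plane R) := [:: 1; -1; 'i; - 'i].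

Lemma dot1 z : dot 1 z = complex.Re z.
Proof. by rewrite /dot /= mul1r mul0r addr0. Qed.

Lemma doti z : dot 'i z = complex.Im z.
Proof. by rewrite /dot /= mul1r mul0r add0r. Qed.

Lemma dotN n z : dot (- n) z = - dot n z.
Proof. by case: n z => a b [c d]; rewrite /dot /=; ring. Qed.

Lemma cbox_dir n y r : n \in dirs ->
  cbox y r = strip n (dot n y - r) (dot n y + r) `&`
             strip (n * 'i) (dot (n * 'i) y - r) (dot (n * 'i) y + r).
Proof.
move=> nd; apply/seteqP; move: nd; rewrite !inE => /or4P[] /eqP->;
  rewrite ?mulN1r ?mul1r ?mulNr ?mulCii ?opprK;
  (split=> [z [/= h1 h2 h3 h4]|z [/andP[h1 h2] /andP[h3 h4]]]);
  move: h1 h2 h3 h4; rewrite /strip /= ?dotN ?dot1 ?doti => h1 h2 h3 h4;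
  do ?[split]; rewrite /=; try (apply/andP; split); lra.
Qed.

Lemma dirs_neq0 n : n \in dirs -> n != 0.
Proof.
rewrite !inE => /or4P[] /eqP->; rewrite ?oppr_eq0; try exact: oner_neq0.
  exact: neq0Ci.
exact: neq0Ci.
Qed.

(** Connectedness im kleinen.  Unless A lies in the box, the components of A in
    the box that come within r / 2 of y are finitely many, since each crosses the
    outer half of the box in one of four directions; those that do not contain y are closed
      and so stay
    away from y. *)
Lemma component_near_point K A y r : compact K -> finitely_crossed K -> is_component K A ->
  A y -> 0 < r ->
  \forall z \near y, A z -> connected_component (A `&` cbox y r) y z.
Proof.
move=> cK fK cA Ay r0.
have cpA : compact A by case: cA => p _ ->; exact: component_compact.
have coA := is_component_connected cA.
have clB : closed (cbox y r) by exact: closed_rect.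
have sqB : sq y r `<=` cbox y r.
  by move=> z [/=]; rewrite !ltr_distl => /andP[? ?] /andP[? ?]; split; exact: ltW.
have [AB|nAB] := pselect (A `<=` cbox y r).
  apply: near_all => z Az; apply: (connected_component_max (B := A)) => // w Aw.
  by split=> //; exact: AB.
pose X := A `&` cbox y r.
have cpX : compact X by exact: compact_closedI.
pose hit := [set C | is_component X C /\ C `&` sq y (r / 2) !=set0].
pose side n := [set C | is_component X C /\ exists D,
  [/\ is_component (A `&` (strip n (dot n y + r / 2) (dot n y + r) `&`
        strip (n * 'i) (dot (n * 'i) y - r) (dot (n * 'i) y + r))) D,
      crosses n (dot n y + r / 2) (dot n y + r) D & D `<=` C]].
have fside n : n \in dirs -> finite_set (side n).
  move=> nd; apply: finite_components; apply: (finite_rect_crossing _ _ cK fK cA).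
    exact: dirs_neq0.
  by lra.
have fhit : finite_set hit.
  apply: (@sub_finite_set _ _ (\bigcup_(n in [set` dirs]) side n)); last first.
    by apply: bigcup_finite => //; exact: finite_set_seq.
  move=> C [cC [z [Cz zy]]].
  have CX := is_component_sub cC.
  have zC := is_componentP cC Cz.
  have [w Cw nw] : exists2 w, C w & ~ sq y r w.
    apply: contrapT => h; apply: nAB.
    apply: (boundary_bumping (O := sq y r) (z := z)) => //.
    - by case: (CX _ Cz).
    - exact: open_sq.
    - rewrite -/X -zC => w Cw; apply: contrapT => nw; apply: h; by exists w.
    - by case: (CX _ Cz).
  (* A side of the box beyond which w lies. *)
  have [n nd [nz nw']] : exists2 n, n \in dirs & dot n z <= dot n y + r / 2 /\ dot n y + r
    <= dot n w.
    move: zy => [/=]; rewrite !ltr_distl => /andP[z1 z2] /andP[z3 z4].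
    have [h|h1] := leP (complex.Re y + r) (complex.Re w).
      by exists 1; rewrite ?inE ?eqxx// !dot1; split; lra.
    have [h|h2] := leP (complex.Re w) (complex.Re y - r).
      by exists (-1); rewrite ?inE ?eqxx ?orbT// !dotN !dot1; split; lra.
    have [h|h3] := leP (complex.Im y + r) (complex.Im w).
      by exists 'i; rewrite ?inE ?eqxx ?orbT// !doti; split; lra.
    have [h|h4] := leP (complex.Im w) (complex.Im y - r).
      by exists (- 'i); rewrite ?inE ?eqxx ?orbT// !dotN !doti; split; lra.
    by exfalso; apply: nw; split; rewrite /= ltr_distl; apply/andP.
  exists n => //; split=> //.
  have cpC : compact C by rewrite zC; exact: component_compact.
  have st : dot n y + r / 2 < dot n y + r by lra.
  have [p [Cp ps [q pq qt]]] := crossing (@dot_continuous R n) cpC (is_component_connected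
    cC) st Cz nz Cw nw'.
  set Y := A `&` _; pose D := connected_component Y p.
  have CY : C `&` [set z | dot n y + r / 2 <= dot n z <= dot n y + r] `<=` Y.
    move=> v [/CX[Av Bv] hv]; split=> //; split=> //.
    by move: Bv; rewrite (cbox_dir _ _ nd) => -[].
  have YX : Y `<=` X.
    move=> v [Av [/andP[v1 v2] v3]]; split=> //; rewrite (cbox_dir _ _ nd); split=> //.
    by apply/andP; split=> //; lra.
  have Yp : Y p by apply: CY; split=> //=; rewrite ps lexx ltW.
  have Dp : D p by exact: connected_component_refl.
  exists D; split; first by exists p.
    split; [exists p|exists q]; split=> //.
    apply: (connected_component_max _ _ _ pq) => //.
    - apply: connected_component_refl; by split=> //=; rewrite ps lexx ltW.
    - by move=> v /connected_component_sub /CY.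
    - exact: component_connected.
  apply: (is_component_max cC) Cp Dp; first exact: component_connected.
  by move=> v /connected_component_sub/YX.
have clU : closed (\bigcup_(C in hit `\ connected_component X y) C).
  apply: closed_bigcup.
    by apply: sub_finite_set fhit => C [].
  by move=> C [[[z _ ->] _] _]; apply: component_closed; exact: plane_compact_closed.
have nU : ~ (\bigcup_(C in hit `\ connected_component X y) C) y.
  by move=> [C [[cC _] nC] Cy]; apply: nC; exact: is_componentP.
have r2 : 0 < r / 2 by rewrite divr_gt0.
have := near_in (@open_sq R y (r / 2)) (sq_center y r2).
have := near_notin clU nU; apply: filterS2 => z nUz zy Az.
have Xz : X z.
  split=> //; apply: sqB; case: zy => ? ?; split; lra.
have zz : connected_component X z z by exact: connected_component_refl.
have [e|ne] := pselect (connected_component X z = connected_component X y).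
  by rewrite -/X -e.
exfalso; apply: nUz; exists (connected_component X z) => //; split=> //.
by split; [exists z|exists z].
Qed.

Lemma crossed_locally_connected K A : compact K -> finitely_crossed K ->
  is_component K A -> locally_connected A.
Proof.
move=> cK fK cA x O Ax oO Ox.
pose Y := connected_component (A `&` O) x.
have YA : Y `<=` A `&` O by exact: connected_component_sub.
have Yx : Y x by exact: connected_component_refl.
have Ynear y : Y y -> \forall z \near y, A z -> Y z.
  move=> Yy; have [Ay Oy] := YA _ Yy.
  have /nbhs_sq[e e0 eO] := near_in oO Oy.
  have r0 : 0 < e / 2 by rewrite divr_gt0.
  apply: filterS (component_near_point cK fK cA Ay r0) => z yz Az.
  apply: connected_component_trans Yy _.
  apply: (connected_component_max _ _ _ (yz Az)).
  - apply: connected_component_refl; split=> //.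
    by split; rewrite /=; lra.
  - move=> w /connected_component_sub[Aw [/= ? ? ? ?]]; split=> //; apply: eO.
    by split; rewrite /= ltr_distl; apply/andP; split; lra.
  - exact: component_connected.
exists [set z | A z -> Y z]°; split.
- exact: open_interior.
- exact: Ynear.
- rewrite (_ : A `&` _ = Y); first exact: component_connected.
  apply/seteqP; split=> z; first by move=> [Az /interior_subset/(_ Az)].
  by move=> Yz; split; [case: (YA _ Yz)|exact: Ynear].
- by move=> z [Az /interior_subset/(_ Az) /YA[]].
Qed.
End LocallyConnected.

Theorem theorem3 (R : realType) (K : set (plane R)) (hK : compact K) :
  schonflies K <->
  (forall A : set (plane R), is_component K A -> peano_continuum A) /\
  (forall c : R, 0 < c ->
     finite_set [set A | is_component K A /\ ~ (diameter A < c%:E)%E]).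
Proof.
rewrite (schonflies_crossed hK); split=> [fK|[peano null]]; last exact: peano_crossed.
split=> [A cA|c c0]; last exact: crossed_null.
split.
- by case: cA => x _ ->; exact: component_compact.
- exact: is_component_connected cA.
- exact: crossed_locally_connected cA.
Qed.
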